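(* Let $n\ge 1$ and $\lambda\in(0,n)$. Then $$\inf_{\nu\in\mathcal{P}}\mathcal{E}_{\infty,\lambda}(\nu)=\Bigl(\sup_{A\subset\mathbb{R}^n}\bigl\{C_\lambda(A)\ \big|\ \operatorname{diam}(A)\le 1\bigr\}\Bigr)^{-1}.$$ Furthermore, the infimum on the left-hand side is attained for some measure $\mu$ with $\operatorname{diam}(\operatorname{supp}\mu)=1$, and the supremum on the right-hand side is attained for some convex body $W\subset\mathbb{R}^n$ of constant width $1$ containing the support of $\mu$. Conversely, if $W$ maximizes $\lambda$-capacity among convex bodies in $\mathbb{R}^n$ of constant width $1$, then the equilibrium measure on $W$ attains the minimum on the left-hand side.
   Context: $\mathcal{P}$ is the set of Borel probability measures on $\mathbb{R}^n$. For $\nu\in\mathcal{P}$ put $$I_\lambda(\nu)=\int_{\mathbb{R}^n}\int_{\mathbb{R}^n}|x-y|^{-\lambda}\,d\nu(x)\,d\nu(y),$$ with $|x-y|^{-\lambda}=+\infty$ if $x=y$, and $$\mathcal{E}_{\infty,\lambda}(\nu)=\begin{cases}I_\lambda(\nu) & \text{if }\operatorname{diam}(\operatorname{supp}\nu)\le 1,\\ +\infty & \text{otherwise.}\end{cases}$$ The $\lambda$-capacity of a set $A\subset\mathbb{R}^n$ is $$C_\lambda(A)=\Bigl(\inf\bigl\{I_\lambda(\nu)\ \big|\ \nu\in\mathcal{P},\ \operatorname{supp}\nu\subset A\bigr\}\Bigr)^{-1},$$ with $C_\lambda(A)=0$ if the infimum is $+\infty$. If $W$ is compact with positive Lebesgue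 measure, the infimum defining $C_\lambda(W)$ is attained by a unique $\mu\in\mathcal{P}$ with $\operatorname{supp}\mu\subset W$, called the equilibrium measure on $W$. A convex body is a compact convex set with non-empty interior; it has constant width $1$ if the distance between its two parallel supporting hyperplanes orthogonal to any given direction equals $1$. *)

(* Defs.v *)
From HB Require Import structures.
From mathcomp Require Import all_boot all_order all_algebra.
From mathcomp Require Import all_classical all_reals all_analysis.

Set Implicit Arguments.
Unset Strict Implicit.
Unset Printing Implicit Defensive.

Import Order.TTheory GRing.Theory Num.Theory.
Import numFieldNormedType.Exports.

Local Open Scope classical_set_scope.
Local Open Scope ring_scope.

Section euclidean_space.
Context {R : realType} {n : nat}.
Implicit Types (x y u : 'rV[R]_n) (A B : set 'rV[R]_n).

Definition dot x y : R := \sum_(i < n) x ord0 i * y ord0 i.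

(* The norm `|x| of the library on 'rV[R]_n is the sup norm: it induces the
   usual topology of R^n but not the Euclidean distance. *)
Definition enorm x : R := Num.sqrt (dot x x).

(* diam set0 = -oo, so the empty set satisfies every bound on the diameter. *)
Definition diam A : \bar R :=
  ereal_sup [set (enorm (x - y))%:E | x in A & y in A].

Definition set_dist A B : \bar R :=
  ereal_inf [set (enorm (x - y))%:E | x in A & y in B].

Definition hyperplane u (c : R) : set 'rV[R]_n := [set x | dot u x = c].

(* hyperplane u c supports A and u is an outer normal; the other supporting
   hyperplane orthogonal to u has outer normal - u. *)
Definition supporting_hyperplane A u (c : R) : Prop :=
  A `<=` [set x | dot u x <= c] /\ A `&` hyperplane u c !=set0.

Definition convex_body A : Prop :=
  [/\ compact A, convex_set A & interior A !=set0].

Definition constant_width A (w : R) : Prop :=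
  forall u, u != 0 -> exists c c' : R,
    [/\ supporting_hyperplane A u c,
        supporting_hyperplane A (- u) c' &
        set_dist (hyperplane u c) (hyperplane (- u) c') = w%:E].

End euclidean_space.

Definition borel_rV (R : realType) (n : nat) :=
  g_sigma_algebraType (@open 'rV[R]_n).

Section riesz_energy.
Context {R : realType} {n : nat}.
Implicit Types (lam : R) (nu : probability (borel_rV R n) R).
Implicit Types A W : set 'rV[R]_n.
Local Open Scope ereal_scope.

Definition supp nu : set 'rV[R]_n :=
  [set x | forall U : set 'rV[R]_n, open U -> U x -> 0 < nu U].

Definition riesz_kernel lam (x y : 'rV[R]_n) : \bar R :=
  if x == y then +oo else (enorm (x - y) `^ (- lam))%:E.

Definition riesz_energy lam nu : \bar R :=
  \int[nu]_y \int[nu]_x riesz_kernel lam x y.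

Definition energy_infty lam nu : \bar R :=
  if diam (supp nu) <= 1 then riesz_energy lam nu else +oo.

Definition min_riesz_energy lam A : \bar R :=
  ereal_inf [set riesz_energy lam nu | nu in [set nu | supp nu `<=` A]].

(* The inverse on \bar R satisfies +oo^-1 = 0 and 0^-1 = +oo. *)
Definition capacity lam A : \bar R := (min_riesz_energy lam A)^-1.

(* Uniqueness on compact sets of positive Lebesgue measure is a theorem, not
   part of the definition. *)
Definition equilibrium_measure lam W nu : Prop :=
  supp nu `<=` W /\ riesz_energy lam nu = min_riesz_energy lam W.

End riesz_energy.

(* Main.v *)
From HB Require Import structures.
Require Import Defs.
From mathcomp Require Import all_boot all_order all_algebra.
From mathcomp Require Import ring lra.
From mathcomp Require Import all_classical all_reals all_analysis.
From mathcomp Require Import measurable_realfun.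

(* The identity is a reformulation: a measure whose support has diameter at most
   1 is a competitor for the capacity of its support, and conversely.

   A minimizer comes from weak compactness: translate a minimizing sequence into
   a fixed ball, take a weak limit along an ultrafilter and use that the energy
   is lower semicontinuous, the kernel being an increasing limit of bounded
   continuous ones.  A dilation shows that the support of a minimizer has
   diameter exactly 1.  By Zorn's lemma a set of diameter at most 1 lies in a
   maximal one, W, which is the intersection of the unit balls centred in W and
   for that reason has constant width 1; enlarging the support of a minimizer to
   W does not change the capacity.  If the infimum is infinite, every measure is
   a minimizer. *)

Set Implicit Arguments.
Unset Strict Implicit.
Unset Printing Implicit Defensive.

Import Order.TTheory GRing.Theory Num.Theory.
Import numFieldNormedType.Exports.

Local Open Scope classical_set_scope.
Local Open Scope ring_scope.

(** * Euclidean geometry and completion to constant width *)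

Section euclidean_geometry.
Context {R : realType} {n : nat}.
Implicit Types (x y z u v w p q : 'rV[R]_n) (A B W : set 'rV[R]_n).

(** Neither subsequences nor product measures occur. Along an ultrafilter the masses of all open
    sets converge at once, but the limiting set function is only finitely additive; the compact set
    carrying all the measures is what makes its inner regularization countably subadditive. Of weak
    convergence only one bound is kept, that the limit gives an open set at most the limit of its
    masses, and integrals are recovered by cutting a continuous function into its open superlevel
    sets. For double integrals, equicontinuity of the regularized potentials turns pointwise into
    uniform convergence. The diameter constraint survives the limit for a different reason: two open
    sets charged by the limit are both charged by a single term of the sequence. On the capacity
    side, inversion is an order-reversing involution of [0, +oo], so zero and infinite values need
    no separate case. The dilation yields a contradiction because the minimum is finite and positive
    there. *)

Lemma dotC x y : dot x y = dot y x.
Proof. by apply: eq_bigr => i _; rewrite mulrC. Qed.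

Lemma dotDl x y z : dot (x + y) z = dot x z + dot y z.
Proof. by rewrite -big_split; apply: eq_bigr => i _; rewrite mxE mulrDl. Qed.

Lemma dotZl (a : R) x y : dot (a *: x) y = a * dot x y.
Proof. by rewrite mulr_sumr; apply: eq_bigr => i _; rewrite mxE mulrA. Qed.

Lemma dotDr x y z : dot x (y + z) = dot x y + dot x z.
Proof. by rewrite !(dotC x) dotDl. Qed.

Lemma dotZr (a : R) x y : dot x (a *: y) = a * dot x y.
Proof. by rewrite !(dotC x) dotZl. Qed.

Lemma dotNl x y : dot (- x) y = - dot x y.
Proof. by rewrite -scaleN1r dotZl mulN1r. Qed.

Lemma dotNr x y : dot x (- y) = - dot x y.
Proof. by rewrite !(dotC x) dotNl. Qed.

Definition dotE := (dotDl, dotDr, dotNl, dotNr, dotZl, dotZr).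

Lemma dot_ge0 x : 0 <= dot x x.
Proof. by apply: sumr_ge0 => i _; rewrite -expr2 sqr_ge0. Qed.

Lemma enorm_ge0 x : 0 <= enorm x.
Proof. exact: sqrtr_ge0. Qed.

Lemma sqr_enorm x : enorm x ^+ 2 = dot x x.
Proof. exact/sqr_sqrtr/dot_ge0. Qed.

Lemma enormZ (a : R) x : enorm (a *: x) = `|a| * enorm x.
Proof.
by rewrite /enorm dotZl dotZr mulrA -expr2 sqrtrM ?sqr_ge0// sqrtr_sqr.
Qed.

Lemma enormN x : enorm (- x) = enorm x.
Proof. by rewrite -scaleN1r enormZ normrN1 mul1r. Qed.

Lemma enormC x y : enorm (x - y) = enorm (y - x).
Proof. by rewrite -enormN opprB. Qed.

Lemma enorm0 : enorm (0 : 'rV[R]_n) = 0.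
Proof. by rewrite -(scale0r 0) enormZ normr0 mul0r. Qed.

Lemma coord_le_enorm x i : `|x ord0 i| <= enorm x.
Proof.
rewrite -sqrtr_sqr ler_wsqrtr// /dot (bigD1 i)//= -expr2 lerDl.
by apply: sumr_ge0 => j _; rewrite -expr2 sqr_ge0.
Qed.

Lemma normr_le_enorm x : `|x| <= enorm x.
Proof.
rewrite [leLHS]mx_normrE; apply/bigmax_leP; split; first exact: enorm_ge0.
by move=> [i j] _ /=; rewrite (ord1 i) coord_le_enorm.
Qed.

Lemma enorm_eq0 x : (enorm x == 0) = (x == 0).
Proof.
apply/idP/idP => [/eqP x0|/eqP->]; last by rewrite enorm0.
by rewrite -normr_le0 -x0 normr_le_enorm.
Qed.

Lemma enorm_gt0 x : (0 < enorm x) = (x != 0).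
Proof. by rewrite lt_def enorm_ge0 andbT enorm_eq0. Qed.

Lemma cauchy_schwarz x y : dot x y <= enorm x * enorm y.
Proof.
have [->|x0] := eqVneq x 0; first by rewrite -(scale0r 0) dotZl enormZ normr0 !mul0r.
have [->|y0] := eqVneq y 0.
  by rewrite -(scale0r 0) dotZr enormZ normr0 !mul0r mulr0.
(* With [N = enorm x * enorm y], this square expands to [2 * N * (N - dot x y)], and the positive
   factor [N] cancels. *)
have := dot_ge0 (enorm y *: x - enorm x *: y).
have xy0 : 0 < enorm x * enorm y by rewrite mulr_gt0// enorm_gt0.
rewrite !dotE -!sqr_enorm (dotC y) => h.
rewrite -(ler_pM2l xy0); lra.
Qed.

Lemma ler_enormD x y : enorm (x + y) <= enorm x + enorm y.
Proof.
rewrite -(@ler_pXn2r _ 2%N)// ?nnegrE ?addr_ge0 ?enorm_ge0//.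
have := cauchy_schwarz x y.
rewrite sqr_enorm !dotE (dotC y) -!sqr_enorm; lra.
Qed.

Lemma enorm_le1 x : (enorm x <= 1) = (dot x x <= 1).
Proof.
by rewrite -[in LHS](@ler_pXn2r _ 2%N)// ?nnegrE ?enorm_ge0// expr1n sqr_enorm.
Qed.

Lemma dot_continuous u : continuous (dot u).
Proof.
apply: continuous_big => [|i _]; first exact: add_continuous.
move=> x; apply: (@continuousM _ _ (fun=> u ord0 i) (fun y => y ord0 i)).
  exact: cst_continuous.
exact: coord_continuous.
Qed.

Lemma enorm_continuous : continuous (@enorm R n).
Proof.
move=> x; apply: (@continuous_comp _ _ _ (fun y => dot y y) Num.sqrt).
  apply: continuous_big => [|i _]; first exact: add_continuous.
  move=> y; apply: (@continuousM _ _ (fun y => y ord0 i) (fun y => y ord0 i));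
    exact: coord_continuous.
exact: sqrt_continuous.
Qed.

Lemma diam_leP A (d : R) :
  (diam A <= d%:E)%E <-> forall x y, A x -> A y -> enorm (x - y) <= d.
Proof.
split=> [Ad x y Ax Ay|Ad].
  by rewrite -lee_fin (le_trans _ Ad)//; apply: ereal_sup_ubound; exists x => //; exists y.
by apply: ge_ereal_sup => _ [x Ax [y Ay <-]]; rewrite lee_fin Ad.
Qed.

Lemma diam_le A B : A `<=` B -> (diam A <= diam B)%E.
Proof.
move=> AB; apply: le_ereal_sup => _ [x Ax [y Ay <-]].
by exists x; [exact: AB|exists y; [exact: AB|]].
Qed.

Lemma bounded_eball (r : R) : bounded_set [set x : 'rV[R]_n | enorm x <= r].
Proof.
exists r; split; first exact: num_real.
by move=> M rM x /= xr; rewrite (le_trans (normr_le_enorm x))// (le_trans xr)// ltW.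
Qed.

Lemma closed_eball p (r : R) : closed [set x : 'rV[R]_n | enorm (x - p) <= r].
Proof.
apply: (@closed_comp _ _ (fun x => enorm (x - p)) [set t | t <= r]).
  move=> x _; apply: (@continuous_comp _ _ _ (fun y => y - p) enorm).
    apply: (@continuousB _ _ _ id (fun=> p)); first exact: cvg_id.
    exact: cst_continuous.
  exact: enorm_continuous.
exact: closed_le.
Qed.

Lemma open_eball p (r : R) : open [set x : 'rV[R]_n | enorm (x - p) < r].
Proof.
apply: (@open_comp _ _ (fun x => enorm (x - p)) [set t | t < r]).
  move=> x _; apply: (@continuous_comp _ _ _ (fun y => y - p) enorm).
    apply: (@continuousB _ _ _ id (fun=> p)); first exact: cvg_id.
    exact: cst_continuous.
  exact: enorm_continuous.
exact: open_lt.
Qed.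

Lemma compact_eball (r : R) : compact [set x : 'rV[R]_n | enorm x <= r].
Proof.
apply: bounded_closed_compact; first exact: bounded_eball.
by have := @closed_eball 0 r; under eq_set do rewrite subr0.
Qed.

(** Diametrically complete sets, normalized to diameter 1, in one equation: the inclusion from left
    to right bounds the diameter by 1, the converse is maximality, since no point outside [W] stays
    within distance 1 of all of [W]. *)
Definition complete W := W = [set z | forall x, W x -> enorm (z - x) <= 1].

Lemma completion A : (diam A <= 1)%E -> exists W, A `<=` W /\ complete W.
Proof.
move=> /diam_leP Ad.
(* The chain condition must also hold for the empty chain, whose union need not contain [A]. Hence
   [A] is put inside the diameter bound instead of being required to lie in [W]; maximality then
   forces [A] into [W]. *)
have [W [/diam_leP Wd Wmax]] :
    exists W, (diam (W `|` A) <= 1)%E /\ forall B, W `<` B -> ~ (diam (B `|` A) <= 1)%E.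
  apply: Zorn_bigcup => F FP Ftot; apply/diam_leP.
  have FA X x y : F X -> (X `|` A) x -> (X `|` A) y -> enorm (x - y) <= 1.
    by move=> /FP/diam_leP; apply.
  move=> x y [[X FX Xx]|Ax] [[Y FY Yy]|Ay].
  - have [XY|YX] := Ftot _ _ FX FY.
      by apply: (FA Y) => //; left => //; exact: XY.
    by apply: (FA X) => //; left => //; exact: YX.
  - by apply: (FA X) => //; [left|right].
  - by apply: (FA Y) => //; [right|left].
  - exact: Ad.
have AW : A `<=` W.
  move=> a Aa; apply: contrapT => nWa; apply: (Wmax (W `|` A)).
    by split=> [x|/(_ a)]; [left|move=> /(_ (or_intror Aa))].
  by rewrite -setUA setUid; apply/diam_leP.
exists W; split=> //; rewrite /complete; apply/seteqP; split=> [z Wz x Wx|z zW].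
  by apply: Wd; left.
apply: contrapT => nWz; apply: (Wmax (W `|` [set z])).
  by split=> [x|/(_ z)]; [left|move=> /(_ (or_intror erefl))].
rewrite setUAC (setUidl AW).
apply/diam_leP => x y [Wx|->] [Wy|->]; [|by rewrite enormC zW|exact: zW|].
- by apply: Wd; left.
- by rewrite subrr enorm0.
Qed.

(** * Complete sets: convexity, opposite support points, interior *)

Section complete_set.
Variable W : set 'rV[R]_n.
Hypothesis Wc : complete W.

Lemma completeP z : W z <-> forall x, W x -> enorm (z - x) <= 1.
Proof. by rewrite [in X in X <-> _]Wc. Qed.

Lemma complete_diam : (diam W <= 1)%E.
Proof. by apply/diam_leP => x y /completeP; apply. Qed.

Lemma complete_compact : W !=set0 -> compact W.
Proof.
move=> [p Wp]; apply: bounded_closed_compact; last first.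
  rewrite Wc (_ : mkset _ = \bigcap_(x in W) [set z | enorm (z - x) <= 1])//.
  by apply: closed_bigI => x _; exact: closed_eball.
have [M [Mr MW]] := bounded_eball (1 + enorm p).
exists M; split=> // N MN x Wx; apply: (MW N MN) => /=.
rewrite -[x in enorm x](subrK p) (le_trans (ler_enormD _ _))// lerD2r.
by move/completeP : Wx; apply.
Qed.

Lemma complete_convex : convex_set W.
Proof.
move=> x y t /set_mem Wx /set_mem Wy; apply/mem_set/completeP => z Wz.
have [t0 t1] : 0 <= t%:num /\ t%:num <= 1 by split.
have -> : conv t x y - z = t%:num *: (x - z) + (1 - t%:num) *: (y - z).
  transitivity (t%:num *: x + (1 - t%:num) *: y - z : 'rV[R]_n) => //.
  by apply/rowP => i; rewrite !mxE; ring.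
rewrite (le_trans (ler_enormD _ _))// !enormZ !ger0_norm ?subr_ge0//.
have /completeP/(_ _ Wz) := Wx; have /completeP/(_ _ Wz) := Wy.
move: (enorm _) (enorm _) => a b a1 b1; nra.
Qed.

(* If some q in W were at distance > 1 from p - u, then v = q - p is steeper
   than the unit circle tangent at p to the supporting hyperplane, and the point
   p + t v + t e u would lie beyond that hyperplane while being, for small t,
   within distance 1 of W. *)
Lemma complete_opposite p u : enorm u = 1 -> W p ->
  (forall x, W x -> dot u x <= dot u p) -> W (p - u).
Proof.
move=> u1 Wp up; apply/completeP => q Wq.
rewrite enormC enorm_le1 leNgt; apply/negP => uq.
have [v qE] : exists v, q = p + v by exists (q - p); rewrite addrC subrK.
have uu : dot u u = 1 by rewrite -sqr_enorm u1 expr1n.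
have vv1 : dot v v <= 1.
  rewrite -enorm_le1 (_ : v = q - p); last by rewrite qE addrC addKr.
  by move/completeP : Wq; apply.
have {}uq : 0 < dot v v + 2 * dot u v.
  move: uq; rewrite (_ : q - (p - u) = v + u).
    by rewrite !dotE uu (dotC v u); lra.
  by rewrite qE opprB addrA addrAC (addrAC p) subrr add0r addrC.
have uv0 : dot u v <= 0.
  by have := up _ Wq; rewrite qE dotDr gerDl.
(* Here [4 * d] is the excess of the squared distance from [q] to [p - u] over 1. The choice of [e]
   gives [dot u (v + e *: u) = d], so [w] lies [t * d] beyond the supporting hyperplane; [t = d / 2]
   keeps the quadratic error [2 * t * t = t * d] below the linear gain [2 * t * d]. *)
have [d dE] : exists d, dot v v = 4 * d - 2 * dot u v.
  by exists ((dot v v + 2 * dot u v) / 4); lra.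
have [e eE] : exists e, e = d - dot u v by exists (d - dot u v).
have [t tE] : exists t, t = d / 2 by exists (d / 2).
have d0 : 0 < d by lra.
have [w wE] : exists w, w = p + (t *: v + (t * e) *: u) by eexists.
suff : W w by move/up; rewrite wE dotDr gerDl !dotE uu eE tE; nra.
apply/completeP => x Wx; rewrite enorm_le1.
have zz : dot (x - p) (x - p) <= 1.
  by rewrite -enorm_le1; move/completeP : Wx; apply.
have zv : dot (x - p - v) (x - p - v) <= 1.
  rewrite -enorm_le1 (_ : x - p - v = x - q); first by move/completeP : Wx; apply.
  by rewrite qE opprD addrA.
have zu : - 1 <= dot u (x - p).
  have := cauchy_schwarz u (- (x - p)).
  rewrite u1 mul1r dotNr enormN; move: zz; rewrite -enorm_le1; lra.
have -> : w - x = t *: v + (t * e) *: u - (x - p).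
  by apply/rowP => i; rewrite wE !mxE; ring.
move: zz zv zu; move: (x - p) => z zz zv zu.
move: zv; rewrite !dotE (dotC v z) (dotC v u) (dotC u z) uu.
rewrite (dotC u z) in zu.
move: (dot z v) (dot z u) (dot z z) (dot u v) (dot v v)
  zz zu uv0 vv1 dE eE {uq} => c s k b a k1 s1 b0 a1 aE eE ck.
have t0 : 0 < t by lra.
(* Here [h1] restates that [x] is within 1 of [q], [h2] that [x - p] has component at least -1 along
   [u], and [h3] that [x] is within 1 of [p]. Together with [h4] to [h6] they bound the squared
   distance from [w] to [x] by [1 - t * d]. *)
have h1 : t * (k - 2 * c + a - 1) <= 0 by nra.
have h2 : 0 <= t * e * (s + 1) by apply: mulr_ge0; [apply: mulr_ge0; lra|lra].
have h3 : (1 - t) * (k - 1) <= 0 by nra.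
have h4 : t * t * (a + 2 * e * b + e * e - 2) <= 0.
  by apply: mulr_ge0_le0; [nra|rewrite eE; nra].
have h5 : t * t * 2 = t * d by rewrite tE; lra.
have h6 : t * (a - 2 * e) = t * (2 * d) by rewrite aE eE; lra.
have h7 : 0 < t * d by rewrite mulr_gt0.
nra.
Qed.

Lemma complete_support u : W !=set0 -> u != 0 ->
  exists2 p, W p & forall x, W x -> dot u x <= dot u p.
Proof.
move=> W0 u0.
have [||p /set_mem Wp pmax] := @compact_EVT_max _ R (dot u) W W0.
- exact: complete_compact.
- by apply: continuous_subspaceT; exact: dot_continuous.
- by exists p => // x /mem_set; exact: pmax.
Qed.

Lemma complete_width u : W !=set0 -> u != 0 ->
  exists p, [/\ W p, W (p - (enorm u)^-1 *: u) &
    forall x, W x -> dot u x <= dot u p].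
Proof.
move=> W0 u0; have [p Wp pmax] := complete_support W0 u0.
have nu0 : 0 < enorm u by rewrite enorm_gt0.
exists p; split=> //; apply: complete_opposite => //.
  by rewrite enormZ ger0_norm ?invr_ge0 ?enorm_ge0// mulVf ?gt_eqF.
by move=> x Wx; rewrite !dotZl ler_pM2l ?invr_gt0// pmax.
Qed.

Lemma complete_convex_body : (0 < n)%N -> W !=set0 -> convex_body W.
Proof.
move=> n0 W0; split; [exact: complete_compact|exact: complete_convex|].
pose u : 'rV[R]_n := const_mx 1.
have u0 : u != 0.
  apply/eqP => /matrixP/(_ ord0 (Ordinal n0)); rewrite !mxE => /eqP.
  by rewrite oner_eq0.
have [p [Wp Wq _]] := complete_width W0 u0.
have [e eE] : exists e, e = (enorm u)^-1 *: u by eexists.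
rewrite -eE in Wq.
have ee : dot e e = 1.
  rewrite eE -sqr_enorm enormZ ger0_norm ?invr_ge0 ?enorm_ge0//.
  by rewrite mulVf ?expr1n// gt_eqF// enorm_gt0.
(* The points [p] and [p - e] of [W] are at distance 1. By the median formula their midpoint [m] has
   squared distance at most [1 - 1/4] to every point of [W], and [3/4 <= (7/8)^2], so the ball of
   radius 1/8 about [m] stays in [W]. *)
pose m := p - 2^-1 *: e; pose r : R := 8^-1.
have mW x : W x -> enorm (m - x) <= 1 - r.
  move=> Wx.
  have : enorm (p - x) <= 1 by move/completeP : Wp; apply.
  have : enorm (p - e - x) <= 1 by move/completeP : Wq; apply.
  rewrite !enorm_le1.
  rewrite -[in X in _ -> _ -> X](@ler_pXn2r _ 2%N)// ?nnegrE ?enorm_ge0//; last first.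
    by rewrite /r; lra.
  rewrite sqr_enorm (_ : p - e - x = (p - x) - e); last by rewrite addrAC.
  rewrite (_ : m - x = (p - x) - 2^-1 *: e); last by rewrite /m addrAC.
  move: (p - x) => z.
  rewrite !dotE (dotC e) ee /r; lra.
exists m; apply: (@filterS _ (nbhs m) _ [set y | enorm (y - m) < r]); last first.
  apply: open_nbhs_nbhs; split; first exact: open_eball.
  by rewrite /= subrr enorm0 /r.
move=> y /= ymr; apply/completeP => x Wx.
rewrite -(subrK m y) -addrA (le_trans (ler_enormD _ _))//.
have := mW _ Wx; lra.
Qed.

End complete_set.

(** The second hyperplane is [dot u y = - c'], whence the sum [c + c']. The feet of the
    perpendiculars from the origin realize the distance, and Cauchy-Schwarz shows that no pair of
    points does better. *)
Lemma dist_hyperplanes u (c c' : R) : u != 0 ->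
  set_dist (hyperplane u c) (hyperplane (- u) c') = (`|c + c'| / enorm u)%:E.
Proof.
move=> u0; have nu0 : 0 < enorm u by rewrite enorm_gt0.
have uu : dot u u != 0 by rewrite -sqr_enorm expf_neq0// gt_eqF.
apply/eqP; rewrite eq_le; apply/andP; split.
  apply: ereal_inf_lbound; exists ((c / dot u u) *: u).
    by rewrite /hyperplane/= dotZr divfK.
  exists ((- c' / dot u u) *: u).
    by rewrite /hyperplane/= dotZr dotNl mulrN divfK// opprK.
  rewrite -scalerBl -mulrBl opprK enormZ normrM normfV.
  by rewrite -sqr_enorm normrX (ger0_norm (enorm_ge0 _)) expr2 invfM !mulrA divfK ?gt_eqF.
apply: le_ereal_inf_tmp => _ [x + [y + <-]].
rewrite /hyperplane/= lee_fin ler_pdivrMr// dotNl => <- <-.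
have -> : dot u x + - dot u y = dot u (x - y) by rewrite !dotE.
rewrite mulrC ler_norml lerNl -dotNr cauchy_schwarz andbT.
by rewrite (le_trans (cauchy_schwarz _ _))// enormN.
Qed.

(** If [p] is a support point with normal [u], then [q], one unit below it, is in [W]. All of [W] is
    within 1 of [p], hence above the parallel hyperplane through [q], which therefore supports [W]
    from the other side. *)
Lemma complete_constant_width W : complete W -> W !=set0 -> constant_width W 1.
Proof.
move=> Wc W0 u u0; have [p [Wp Wq pmax]] := complete_width Wc W0 u0.
have nu0 : 0 < enorm u by rewrite enorm_gt0.
set q := p - _ in Wq.
have qE : dot u q = dot u p - enorm u.
  rewrite /q !dotE -sqr_enorm expr2 mulrA mulVf ?mul1r ?gt_eqF//.
exists (dot u p), (dot (- u) q); split.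
- by split=> //; exists p.
- split; last by exists q.
  move=> x Wx /=; rewrite !dotNl lerN2 qE lerBlDr -lerBlDl.
  have -> : dot u p - dot u x = dot u (p - x) by rewrite !dotE.
  rewrite (le_trans (cauchy_schwarz _ _))// ler_piMr ?enorm_ge0//.
  by move/(completeP Wc) : Wp; apply.
- rewrite dist_hyperplanes// dotNl qE opprB addrCA subrr addr0.
  by rewrite gtr0_norm// divff// gt_eqF.
Qed.

(** The width is used in the direction [x - y] itself: the two supporting inequalities bound the
    square of [enorm (x - y)] by [c + c'], whose absolute value is [enorm (x - y)]. *)
Lemma constant_width_diam W : constant_width W 1 -> (diam W <= 1)%E.
Proof.
move=> Ww; apply/diam_leP => x y Wx Wy.
have [->|xy] := eqVneq x y; first by rewrite subrr enorm0.
have u0 : x - y != 0 by rewrite subr_eq0.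
have nu0 : 0 < enorm (x - y) by rewrite enorm_gt0.
have [c [c' [[Wc _] [Wc' _]]]] := Ww _ u0.
rewrite dist_hyperplanes// => -[] /(congr1 ( *%R^~ (enorm (x - y)))).
rewrite divfK ?gt_eqF// mul1r => cc'.
rewrite -(ler_pM2r nu0) mul1r -[X in _ <= X]cc' -expr2 sqr_enorm.
rewrite (le_trans _ (ler_norm _))//.
have -> : dot (x - y) (x - y) = dot (x - y) x + dot (- (x - y)) y.
  by rewrite [LHS]dotDr dotNr dotNl.
by rewrite lerD//; [exact: Wc|exact: Wc'].
Qed.

End euclidean_geometry.

(** * Weak limits of probability measures along an ultrafilter *)

Section ultrafilter_limits.
Context {R : realType} (U : set_system nat) {UU : UltraFilter U}.

Lemma ultra_fmap (T : Type) (f : nat -> T) : UltraFilter (f @ U).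
Proof.
split; first exact: fmap_proper_filter.
move=> G GF fUG; apply/seteqP; split=> // A GA.
have [//|UnA] := in_ultra_setVsetC (f @^-1` A) UU.
exfalso; have : G (~` A `&` A) by apply: filterI => //; exact: fUG.
by rewrite setICl => /filter_not_empty.
Qed.

(** Compactness of the segment replaces the extraction of a subsequence, so one [U] serves for
    uncountably many bounded sequences, such as the masses of all open sets. *)
Lemma ultra_is_cvg (f : nat -> R) (a b : R) :
  (forall k, a <= f k <= b) -> cvg (f @ U).
Proof.
move=> fab; have fU := ultra_fmap f.
have := @segment_compact R a b; rewrite compact_ultra => /(_ (f @ U) fU).
have fabU : (f @ U) `[a, b]%classic.
  by apply: (@filterE _ U) => k /=; rewrite in_itv/=; exact: fab.
by move=> /(_ fabU)[p [_ fp]]; apply/cvg_ex; exists p.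
Qed.

Lemma ultra_ler_lim (f g : nat -> R) (l l' : R) :
  f @ U --> l -> g @ U --> l' -> (\near U, f U <= g U) -> l <= l'.
Proof. exact: ler_cvg_to. Qed.

End ultrafilter_limits.

(** * Inner approximation of open sets *)

Section shrinking.
Context {R : realType} {n : nat}.
Implicit Types (G H : set 'rV[R]_n).

(** The erosion of [H] by a ball of radius [r], made open by taking its interior. Its closure stays
    in [H], and for [r] tending to 0 these sets exhaust an open [H]. *)
Definition inner_set (r : R) H : set 'rV[R]_n := interior [set x | ball x r `<=` H].

Lemma open_inner_set r H : open (inner_set r H).
Proof. exact: open_interior. Qed.

Lemma closure_inner_set r H : 0 < r -> closure (inner_set r H) `<=` H.
Proof.
move=> r0 x clx; have [y [/interior_subset /= yH]] := clx _ (nbhsx_ballx x r r0).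
by move=> xy; apply: yH; exact: ball_sym.
Qed.

Lemma inner_set_near H x : open H -> H x ->
  \forall y \near x & k \near \oo, inner_set k.+1%:R^-1 H y.
Proof.
move=> oH Hx; have : nbhs x H by exact: open_nbhs_nbhs.
move=> /nbhs_ballP[e /= e0 xeH].
have e20 : 0 < e / 2 by rewrite divr_gt0.
exists (interior (ball x (e / 2)), [set k | k.+1%:R^-1 < e / 2]).
  split=> /=.
    by apply: open_nbhs_nbhs; split; [exact: open_interior|exact: nbhsx_ballx].
  exact: near_infty_natSinv_lt (PosNum e20).
move=> [y k] [/= xy ke].
apply: filterS xy => z xz w zw; apply: xeH; rewrite (splitr e).
by apply: ball_triangle xz _; apply: le_ball zw; exact: ltW.
Qed.

End shrinking.

Section borel_rV.
Context {R : realType} {n : nat}.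
Implicit Types A O : set 'rV[R]_n.

Lemma borel_open O : open O -> @measurable _ (borel_rV R n) O.
Proof. exact: sub_sigma_algebra. Qed.

Lemma borel_closed A : closed A -> @measurable _ (borel_rV R n) A.
Proof.
move=> cA; rewrite -(setCK A).
by apply: (@measurableC _ (borel_rV R n)); apply: borel_open; exact: closed_openC.
Qed.

Lemma borel_compact A : compact A -> @measurable _ (borel_rV R n) A.
Proof. by move=> cA; apply: borel_closed; apply: compact_closed => //; exact: norm_hausdorff. Qed.

Lemma continuous_borel (f : 'rV[R]_n -> R) :
  continuous f -> measurable_fun [set: borel_rV R n] f.
Proof.
move=> cf; apply: (measurability _ (RGenOpens.measurableE R)).
move=> _ [_ [a [b ->] <-]]; rewrite setTI; apply: borel_open.
by apply: open_comp => [x _|]; [exact: cf|exact: interval_open].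
Qed.

Lemma fine_probability_itv (P : probability (borel_rV R n) R) O : open O ->
  0 <= fine (P O) <= 1.
Proof.
move=> /borel_open mO; rewrite fine_ge0//= -lee_fin fineK; last exact: fin_num_measure.
exact: probability_le1.
Qed.

Lemma fine_probabilityK (P : probability (borel_rV R n) R) O : open O ->
  (fine (P O))%:E = P O.
Proof. by move=> /borel_open mO; rewrite fineK//; exact: fin_num_measure. Qed.

End borel_rV.

(** * Construction of the limit measure *)

Section weak_limit.
Context {R : realType} {n : nat}.
Notation V := 'rV[R]_n.
Variables (U : set_system nat) (UU : UltraFilter U).
Variables (nu : nat -> probability (borel_rV R n) R) (K : set V).
Hypotheses (Kc : compact K) (nuK : forall k, nu k (~` K) = 0%E).
Implicit Types (A B G H : set V).

Let tau A : R := lim ((fun k => fine (nu k A)) @ U).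

Let tau_cvg A : open A -> (fun k => fine (nu k A)) @ U --> tau A.
Proof.
by move=> oA; apply: (@ultra_is_cvg _ U UU _ 0 1) => k; exact: fine_probability_itv.
Qed.

Let tau0 : tau set0 = 0.
Proof.
rewrite /tau (_ : (fun k => _) = cst 0) ?lim_cst//.
by apply/funext => k; rewrite measure0.
Qed.

Let tauT : tau setT = 1.
Proof.
rewrite /tau (_ : (fun k => _) = cst 1) ?lim_cst//.
by apply/funext => k; rewrite probability_setT.
Qed.

Let tauU A B : open A -> open B -> A `&` B = set0 -> tau (A `|` B) = tau A + tau B.
Proof.
move=> oA oB AB; apply: cvg_lim => //.
have -> : (fun k => fine (nu k (A `|` B))) =
    (fun k => fine (nu k A)) \+ (fun k => fine (nu k B)).
  apply/funext => k /=; rewrite measureU//; [|exact: borel_open|exact: borel_open].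
  by rewrite fineD//; apply: fin_num_measure; exact: borel_open.
by apply: cvgD; exact: tau_cvg.
Qed.

(** Only the part of [B] inside [K] has to be covered, because every [nu k] vanishes outside [K].
    This is how the common compact set enters the construction. *)
Let tau_le_sum B N (F : nat -> set V) : open B -> (forall i, open (F i)) ->
  B `&` K `<=` \big[setU/set0]_(i < N) F i -> tau B <= \sum_(i < N) tau (F i).
Proof.
move=> oO oF OF.
apply: (@ultra_ler_lim _ U UU (fun k => fine (nu k B))
  (fun k => \sum_(i < N) fine (nu k (F i)))).
- exact: tau_cvg.
- apply: cvg_big => [|i _]; first exact: add_continuous.
  exact: tau_cvg.
apply: filterE => k.
have mF i : @measurable _ (borel_rV R n) (F i) by exact: borel_open.
have mK : @measurable _ (borel_rV R n) K.
  exact: borel_compact.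
have mO : @measurable _ (borel_rV R n) B by exact: borel_open.
rewrite -lee_fin -sumEFin fineK; last exact: fin_num_measure.
under eq_bigr do rewrite fineK ?fin_num_measure//.
apply: le_trans (Boole_inequality (nu k) (fun i _ => mF i)).
rewrite -[leRHS]adde0 -(nuK k).
apply: le_trans (measureU2 _ _ _) => //; last first.
- by apply: (@measurableC _ (borel_rV R n)).
- by apply: (@bigsetU_measurable _ (borel_rV R n)).
apply: le_measure; rewrite ?inE//.
  apply: (@measurableU _ (borel_rV R n)); first exact: (@bigsetU_measurable _ (borel_rV R n)).
  exact: (@measurableC _ (borel_rV R n)).
by move=> x Ox; have [Kx|nKx] := pselect (K x); [left; apply: OF|right].
Qed.

(* sigma is the candidate measure on open sets: tau regularized from inside, as
   tau itself is only finitely additive. *)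
Let sigma H : \bar R := ereal_sup
  [set (tau B)%:E | B in [set B | open B /\ closure B `<=` H]].

Let sigma_ge H B : open B -> closure B `<=` H -> ((tau B)%:E <= sigma H)%E.
Proof. by move=> oO OH; apply: ereal_sup_ubound; exists B. Qed.

Let sigma_ge0 H : (0 <= sigma H)%E.
Proof.
have <- : (tau set0)%:E = 0%E by rewrite tau0.
by apply: sigma_ge; [exact: open0|rewrite closure0].
Qed.

Let sigmaS G H : G `<=` H -> (sigma G <= sigma H)%E.
Proof.
move=> GH; apply: le_ereal_sup => _ [B [oO OG] <-]; exists B => //.
by split=> //; exact: subset_trans GH.
Qed.

Let tau_le A B : open A -> open B -> A `<=` B -> tau A <= tau B.
Proof.
move=> oA oB AB; have := @tau_le_sum A 1 (fun=> B) oA (fun=> oB).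
by rewrite !big_ord1; apply => x [/AB].
Qed.

Let sigma_le H : open H -> (sigma H <= (tau H)%:E)%E.
Proof.
move=> oH; apply: ge_ereal_sup => _ [B [oO OH] <-]; rewrite lee_fin tau_le//.
by apply: subset_trans OH; exact: subset_closure.
Qed.

Let sigma0 : sigma set0 = 0%E.
Proof.
apply/eqP; rewrite eq_le sigma_ge0 andbT.
have <- : (tau set0)%:E = 0%E by rewrite tau0.
by rewrite sigma_le//; exact: open0.
Qed.

Let sigmaT : sigma setT = 1%E.
Proof.
apply/eqP; rewrite eq_le -tauT sigma_le/=; last exact: openT.
by rewrite sigma_ge//; exact: openT.
Qed.

(** The part of the closure of [B] in [K] is compact, so a single [N] exists such that the first [N]
    sets, eroded by [1 / N.+1], cover it: the same index bounds the number of sets and fixes the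
    erosion. Eroded sets are admissible in the supremum defining [sigma (H i)]. *)
Let sigma_bigcup (H : nat -> set V) : (forall i, open (H i)) ->
  (sigma (\bigcup_i H i) <= \sum_(0 <= i <oo) sigma (H i))%E.
Proof.
move=> oH; apply: ge_ereal_sup => _ [B [oO OH] <-].
have : compact (K `&` closure B) by apply: compact_closedI => //; exact: closed_closure.
move/compact_near_coveringP => /(_ nat \oo
  (fun N x => exists2 i, (i < N)%N & inner_set N.+1%:R^-1 (H i) x) _).
case.
  move=> x [_ /OH[i _ Hix]].
  have [[A N] /= [nA nN] AN] := inner_set_near (oH i) Hix.
  exists (A, N `&` [set k | (i < k)%N]) => /=.
    by split=> //; apply: filterI => //; exact: nbhs_infty_gt.
  by move=> [y k] /= [Ay [Nk ik]]; exists i => //; exact: (AN (y, k)).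
move=> N _ /(_ N (leqnn N)) /= KN.
apply: (@le_trans _ _ (\sum_(i < N) tau (inner_set N.+1%:R^-1 (H i)))%:E).
  rewrite lee_fin.
  apply: (@tau_le_sum B N (fun i => inner_set N.+1%:R^-1 (H i))) => //.
    by move=> i; exact: open_inner_set.
  move=> x [Ox Kx]; have [|i iN xi] := KN x.
    by split=> //; exact: subset_closure.
  by rewrite -(bigcup_mkord N (fun i => inner_set N.+1%:R^-1 (H i))); exists i.
rewrite -sumEFin.
apply: (@le_trans _ _ (\sum_(0 <= i < N) sigma (H i))%E).
  rewrite big_mkord; apply: lee_sum => i _; apply: sigma_ge.
    exact: open_inner_set.
  exact: closure_inner_set.
exact: nneseries_lim_ge.
Qed.

Let mu A : \bar R := ereal_inf [set sigma H | H in [set H | open H /\ A `<=` H]].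

Let mu_le A H : open H -> A `<=` H -> (mu A <= sigma H)%E.
Proof. by move=> oH AH; apply: ereal_inf_lbound; exists H. Qed.

Let mu_open H : open H -> mu H = sigma H.
Proof.
move=> oH; apply/eqP; rewrite eq_le mu_le//=.
by apply: le_ereal_inf_tmp => _ [G [oG HG] <-]; exact: sigmaS.
Qed.

Let mu_ge0 A : (0 <= mu A)%E.
Proof. by apply: le_ereal_inf_tmp => _ [H _ <-]. Qed.

Let muS A B : A `<=` B -> (mu A <= mu B)%E.
Proof.
move=> AB; apply: le_ereal_inf => _ [H [oH BH] <-]; exists H => //.
by split=> //; exact: subset_trans BH.
Qed.

Let mu0 : mu set0 = 0%E.
Proof. by rewrite mu_open ?sigma0//; exact: open0. Qed.

Let mu_fin A : mu A \is a fin_num.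
Proof.
have : (mu A <= 1)%E by rewrite -sigmaT mu_le//; exact: openT.
by rewrite ge0_fin_numE// => /le_lt_trans; apply; rewrite ltry.
Qed.

Let mu_sigma_subadditive : sigma_subadditive mu.
Proof.
move=> F; apply/lee_addgt0Pr => e e0.
have /choice[G PG] i : exists G, [/\ open G, F i `<=` G &
    (sigma G <= mu (F i) + (e / (2 ^ i.+1)%:R)%:E)%E].
  have ei0 : 0 < e / (2 ^ i.+1)%:R by rewrite divr_gt0// ltr0n expn_gt0.
  have [_ [G [oG FG] <-] /ltW] := lb_ereal_inf_adherent ei0 (mu_fin (F i)).
  by exists G.
apply: le_trans (epsilon_trick _ _ (ltW e0)) => //.
apply: (@le_trans _ _ (\sum_(0 <= i <oo) sigma (G i))%E).
  apply: le_trans (sigma_bigcup _); last by move=> i; case: (PG i).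
  apply: mu_le; first by apply: bigcup_open => i _; case: (PG i).
  by move=> x [i _ Fx]; exists i => //; case: (PG i) => _ + _; apply.
apply: lee_nneseries => [i|i _]; last by case: (PG i).
by move=> *; exact: sigma_ge0.
Qed.

(** For [H] open around [A] and [B] with closure in both [H] and [G], the set [H] minus the closure
    of [B] is open and contains [A] minus [G]. Any [B'] with closure in it is disjoint from [B], so
    [tau] is additive on the two, and their union is admissible for [sigma H]. *)
Let mu_caratheodory_open G : open G -> forall A,
  (mu (A `&` G) + mu (A `&` ~` G) <= mu A)%E.
Proof.
move=> oG A; apply: le_ereal_inf_tmp => _ [H [oH AH] <-].
have oHG : open (H `&` G) by exact: openI.
apply: (@le_trans _ _ (sigma (H `&` G) + mu (A `&` ~` G))%E).
  by rewrite leeD2r// mu_le//; exact: setSI.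
rewrite -leeBrDr ?mu_fin//; apply: ge_ereal_sup => _ [B [oO OHG] <-].
rewrite leeBrDr ?mu_fin// addeC.
have oHO : open (H `&` ~` closure B).
  by apply: openI => //; apply: closed_openC; exact: closed_closure.
apply: (@le_trans _ _ (sigma (H `&` ~` closure B) + (tau B)%:E)%E).
  rewrite leeD2r// mu_le// => x [Ax nGx]; split; first exact: AH.
  by move=> /OHG[].
rewrite -leeBrDr//; apply: ge_ereal_sup => _ [B' [oO' B'HO] <-].
rewrite leeBrDr// -EFinD -tauU//; last first.
  by apply/seteqP; split=> // x [/subset_closure/B'HO[_ +] /subset_closure].
apply: sigma_ge; first exact: openU.
by rewrite closureU => x [/B'HO[]|/OHG[]].
Qed.

(** The bound on open sets is the portmanteau form of weak convergence, and the later convergence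
    results use nothing else about [m]. Open sets being Caratheodory measurable, the outer measure
    [mu] restricts to a measure on Borel sets. *)
Lemma weak_limit_exists : exists m : probability (borel_rV R n) R,
  forall B, open B ->
    (m B <= (lim ((fun k => fine (nu k B)) @ U))%:E)%E.
Proof.
pose om : {outer_measure set V -> \bar R} := HB.pack mu
  (isOuterMeasure.Build R V mu mu0 mu_ge0 muS mu_sigma_subadditive).
have borel_cara : @measurable _ (borel_rV R n) `<=` om.-caratheodory.
  apply: smallest_sub => [|G oG].
    exact: (sigma_algebra_measurable (caratheodory_type om)).
  by apply: le_caratheodory_measurable => A; exact: mu_caratheodory_open.
have mu_sigma_additive : semi_sigma_additive (mu : set (borel_rV R n) -> \bar R).
  move=> F mF tF mUF.
  apply: (@caratheodory_measure_sigma_additive _ _ om) => //.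
    by move=> i; exact: borel_cara.
  exact: borel_cara.
pose mm := isMeasure.Build _ (borel_rV R n) R (mu : set (borel_rV R n) -> \bar R)
  mu0 mu_ge0 mu_sigma_additive.
pose m0 : {measure set (borel_rV R n) -> \bar R} :=
  HB.pack (mu : set (borel_rV R n) -> \bar R) mm.
have muT : m0 setT = 1%E by rewrite [LHS]mu_open ?sigmaT//; exact: openT.
pose m : probability (borel_rV R n) R :=
  HB.pack (mu : set (borel_rV R n) -> \bar R) mm
    (Measure_isProbability.Build _ _ _ m0 muT).
by exists m => B oO; rewrite [X in (X <= _)%E]mu_open// sigma_le.
Qed.

End weak_limit.

(** * Integrals of bounded continuous functions *)

Section bounded_continuous.
Context {R : realType} {n : nat}.
Notation V := 'rV[R]_n.
Implicit Types (P : probability (borel_rV R n) R) (f g : V -> R) (K : set V).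

Lemma continuous_integrable P f (b : R) : continuous f ->
  (forall x, `|f x| <= b) -> P.-integrable setT (EFin \o f).
Proof.
move=> cf fb; apply: measurable_bounded_integrable => //.
- by apply: (@le_lt_trans _ _ 1%E); [exact: probability_le1|rewrite ltry].
- exact: continuous_borel.
- exists b; split; first exact: num_real.
  by move=> M bM x _; rewrite /= (le_trans (fb x))// ltW.
Qed.

Lemma Rintegral_itv P f (b : R) : continuous f ->
  (forall x, 0 <= f x <= b) -> 0 <= \int[P]_x f x <= b.
Proof.
move=> cf fb; apply/andP; split.
  by apply: Rintegral_ge0 => x _; case/andP: (fb x).
rewrite (_ : b = \int[P]_x b); last first.
  by rewrite Rintegral_cst//= [X in fine X](probability_setT P) mulr1.
apply: le_Rintegral => //.
- apply: (@continuous_integrable _ _ b) => // x.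
  by case/andP: (fb x) => *; rewrite ger0_norm.
- by apply: (@continuous_integrable _ _ `|b|); first exact: cst_continuous.
- by move=> x _; case/andP: (fb x).
Qed.

Lemma Rintegral_dist P K f g (b e : R) : compact K -> P (~` K) = 0%E ->
  continuous f -> continuous g ->
  (forall x, `|f x| <= b) -> (forall x, `|g x| <= b) ->
  (forall x, K x -> `|f x - g x| <= e) ->
  `|\int[P]_x f x - \int[P]_x g x| <= e.
Proof.
move=> cK PK cf cg fb gb fge.
have If := continuous_integrable P cf fb.
have Ig := continuous_integrable P cg gb.
have cfg : continuous (f \- g) by move=> x; apply: continuousB; [exact: cf|exact: cg].
have fgb x : `|(f \- g) x| <= b + b by rewrite (le_trans (ler_normB _ _))// lerD.
have Ifg := continuous_integrable P cfg fgb.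
rewrite -RintegralB// (le_trans (le_normr_Rintegral _ Ifg))//.
have e0 : 0 <= e.
  have [[x Kx]|nK] := pselect (exists x, K x); first exact: le_trans (fge x Kx).
  have : P setT = 0%E by rewrite -PK; congr (P _);
    apply/seteqP; split=> // x _ Kx; apply: nK; exists x.
  by rewrite probability_setT => -[] /eqP; rewrite oner_eq0.
rewrite /Rintegral -[leRHS]/(fine e%:E) fine_le//.
- apply: integrable_fin_num => //.
  exact: (integrable_abse Ifg).
rewrite -[leRHS](_ : (\int[P]_x cst e%:E x)%E = _); last first.
  by rewrite integral_cst//= [X in (_ * X)%E](probability_setT P) mule1.
apply: ae_ge0_le_integral => //.
- apply: measurableT_comp => //; apply: measurableT_comp => //.
  exact: continuous_borel.
- exists (~` K); split => //.
    by apply: (@measurableC _ (borel_rV R n)); exact: borel_compact.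
  move=> x /= nx Kx; apply: nx => _; rewrite lee_fin; exact: fge.
Qed.

Lemma layer_sum (N : nat) (s : R) : 0 <= s <= N%:R ->
  \sum_(i < N) (i.+1%:R < s)%R%:R <= s <= \sum_(i < N) (i.+1%:R < s)%R%:R + 1.
Proof.
elim: N => [|N IH] /andP[s0 sN].
  by rewrite big_ord0 s0 add0r (le_trans sN).
rewrite big_ord_recr/= (ltNge N.+1%:R) sN addr0.
have [sN'|Ns] := leP s N%:R; first by rewrite IH// s0.
rewrite (eq_bigr (fun=> 1)) => [|i _]; last first.
  by rewrite (le_lt_trans _ Ns)// ler_nat.
by rewrite sumr_const card_ord (ltW Ns)/= natr1.
Qed.

(** A layer-cake formula with integer levels: the sum in [layer_sum] counts the positive integers
    below [f x], which is [f x] up to 1. It reduces integrals to masses of open sets, and the error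
    1 is made negligible by scaling [f]. *)
Lemma integral_layer P f (N : nat) : continuous f ->
  (forall x, 0 <= f x <= N%:R) ->
  (\sum_(i < N) P [set x | (i.+1%:R < f x)%R] <= \int[P]_x (f x)%:E
   <= \sum_(i < N) P [set x | (i.+1%:R < f x)%R] + 1)%E.
Proof.
move=> cf fN; pose A (i : nat) := [set x | i.+1%:R < f x].
have oA i : open (A i) by apply: (open_comp _ (@open_gt R i.+1%:R)) => x _; exact: cf.
have mA i : @measurable _ (borel_rV R n) (A i) by exact: borel_open.
have IE : (\int[P]_x (\sum_(i < N) (\1_(A i) x : R)%:E) = \sum_(i < N) P (A i))%E.
  rewrite (@ge0_integral_sum _ _ _ P setT _ _ (fun (i : 'I_N) x => (\1_(A i) x : R)%:E)) //.
  - by apply: eq_bigr => i _; rewrite integral_indic// setIT.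
  by move=> i; apply: measurableT_comp => //; exact: measurable_indic.
have E x : (\sum_(i < N) (\1_(A i) x : R)%:E =
    (\sum_(i < N) ((i.+1%:R < f x)%R%:R : R))%R%:E)%E.
  rewrite sumEFin; congr EFin; apply: eq_bigr => i _.
  by rewrite indicE; congr (_%:R); rewrite /A mem_setE.
have mS : measurable_fun [set: borel_rV R n] (fun x => (\sum_(i < N) (\1_(A i) x : R)%:E)%E).
  by apply: emeasurable_sum => i; apply: measurableT_comp => //; exact: measurable_indic.
have S0 x : (0 <= \sum_(i < N) (\1_(A i) x : R)%:E)%E.
  by rewrite sume_ge0// => i _; rewrite lee_fin.
have mf : measurable_fun [set: borel_rV R n] (EFin \o f).
  by apply: measurableT_comp => //; exact: continuous_borel.
rewrite -IE; apply/andP; split.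
  apply: ge0_le_integral => //.
  by move=> x _; rewrite E lee_fin; case/andP: (layer_sum (fN x)).
rewrite -[X in (_ + X)%E](_ : (\int[P]_x cst 1 x = 1)%E); last first.
  by rewrite integral_cst//= [X in (_ * X)%E](probability_setT P) mule1.
rewrite -ge0_integralD//.
apply: ge0_le_integral => //.
- by move=> x _; rewrite lee_fin; case/andP: (fN x).
- exact: emeasurable_funD.
- by move=> x _; rewrite E /= -EFinD lee_fin; case/andP: (layer_sum (fN x)).
Qed.

End bounded_continuous.

(** * Convergence of single and double integrals *)

Section weak_convergence.
Context {R : realType} {n : nat}.
Notation V := 'rV[R]_n.
Variables (U : set_system nat) (UU : UltraFilter U).
Variables (nu : nat -> probability (borel_rV R n) R) (K : set V).
Hypotheses (Kc : compact K) (nuK : forall k, nu k (~` K) = 0%E).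
Variable m : probability (borel_rV R n) R.
Implicit Types P : probability (borel_rV R n) R.
Hypothesis nu_m : forall O, open O ->
  (m O <= (lim ((fun k => fine (nu k O)) @ U))%:E)%E.

Lemma weak_limit_gt0 O : open O -> (0 < m O)%E -> \forall k \near U, (0 < nu k O)%E.
Proof.
move=> oO mO; have /(lt_le_trans mO) := nu_m oO; rewrite lte_fin => L0.
have cO : cvg ((fun k => fine (nu k O)) @ U).
  by apply: (@ultra_is_cvg _ U UU _ 0 1) => k; exact: fine_probability_itv.
move/cvgr_gt : cO => /(_ _ L0); apply: filterS => k.
by rewrite -lte_fin fine_probabilityK.
Qed.

Lemma weak_limit_compl : m (~` K) = 0%E.
Proof.
have oK : open (~` K).
  by apply: closed_openC; apply: compact_closed => //; exact: norm_hausdorff.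
apply/eqP; rewrite eq_le measure_ge0 andbT (le_trans (nu_m oK))//.
by rewrite (_ : (fun k => _) = cst 0) ?lim_cst//; apply/funext => k; rewrite nuK.
Qed.

Lemma integral_le_lim (f : V -> R) (b : R) : continuous f -> (forall x, 0 <= f x <= b) ->
  \int[m]_x f x <= lim ((fun k => \int[nu k]_x f x) @ U).
Proof.
move=> cf fb; set L := lim _.
have cL : (fun k => \int[nu k]_x f x) @ U --> L.
  by apply: (@ultra_is_cvg _ U UU _ 0 b) => k; exact: Rintegral_itv.
apply/ler_addgt0Pr => e e0.
(* Multiplying [f] by [c.+1], where [1 / c.+1 < e], makes the error 1 of [integral_layer] at most
   [c.+1 * e], that is, [e] after scaling back. *)
have [c _ /(_ c (leqnn c)) ce] := near_infty_natSinv_lt (PosNum e0).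
have c0 : (0 : R) < c.+1%:R by [].
rewrite -(ler_pM2l c0) mulrDr.
have If P : P.-integrable setT (EFin \o f).
  apply: (@continuous_integrable _ _ _ _ b) => // x.
  by case/andP: (fb x) => *; rewrite ger0_norm.
rewrite -RintegralZl//; last exact: If.
have cg : continuous (fun x => c.+1%:R * f x).
  move=> x; apply: (@continuousM _ _ (fun=> c.+1%:R) f); last exact: cf.
  exact: cst_continuous.
have [N cbN] : exists N : nat, c.+1%:R * b <= N%:R.
  by exists (Num.truncn (c.+1%:R * b)).+1; rewrite ltW// truncnS_gt.
have gN x : 0 <= c.+1%:R * f x <= N%:R.
  case/andP: (fb x) => f0 fxb; rewrite mulr_ge0//= (le_trans _ cbN)//.
  by rewrite ler_pM2l.
have Ig P : P.-integrable setT (EFin \o (fun x => c.+1%:R * f x)).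
  apply: (@continuous_integrable _ _ _ _ N%:R) => // x.
  by case/andP: (gN x) => *; rewrite ger0_norm.
pose A (i : nat) := [set x | i.+1%:R < c.+1%:R * f x].
have oA i : open (A i) by apply: (open_comp _ (@open_gt R i.+1%:R)) => x _; exact: cg.
have intE P : (\int[P]_x (c.+1%:R * f x)%:E)%E = (\int[P]_x (c.+1%:R * f x))%:E.
  by rewrite /Rintegral fineK//; exact: (integrable_fin_num _ (Ig P)).
have sumE P : (\sum_(i < N) P (A i))%E = (\sum_(i < N) fine (P (A i)))%:E.
  by rewrite -sumEFin; apply: eq_bigr => i _; rewrite fine_probabilityK.
have /andP[_] := integral_layer m cg gN.
rewrite intE sumE -EFinD lee_fin => /le_trans; apply.
have ec : 1 <= c.+1%:R * e by rewrite -ler_pdivrMl// mulr1 ltW.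
rewrite lerD//.
apply: (@le_trans _ _ (\sum_(i < N) lim ((fun k => fine (nu k (A i))) @ U))).
  by apply: ler_sum => i _; rewrite -lee_fin fine_probabilityK// nu_m.
apply: (@ultra_ler_lim _ U UU (fun k => \sum_(i < N) fine (nu k (A i)))
  (fun k => c.+1%:R * \int[nu k]_x f x)).
- apply: cvg_big => [|i _]; first exact: add_continuous.
  by apply: (@ultra_is_cvg _ U UU _ 0 1) => k; exact: fine_probability_itv.
- by apply: cvgM => //; exact: cvg_cst.
- apply: filterE => k; rewrite -RintegralZl//; last exact: If.
  by have /andP[+ _] := integral_layer (nu k) cg gN; rewrite intE sumE lee_fin.
Qed.

(** The missing inequality is [integral_le_lim] for [b - f], which takes values in the same
    interval; total mass 1 turns it into an upper bound for the limit. *)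
Lemma cvg_integral (f : V -> R) (b : R) : continuous f -> (forall x, 0 <= f x <= b) ->
  (fun k => \int[nu k]_x f x) @ U --> \int[m]_x f x.
Proof.
move=> cf fb; set L := lim ((fun k => \int[nu k]_x f x) @ U).
have cL : (fun k => \int[nu k]_x f x) @ U --> L.
  by apply: (@ultra_is_cvg _ U UU _ 0 b) => k; exact: Rintegral_itv.
suff -> : \int[m]_x f x = L by [].
apply/eqP; rewrite eq_le (integral_le_lim cf fb)/=.
have cg : continuous (fun x => b - f x).
  by move=> x; apply: (@continuousB _ _ _ (fun=> b) f); [exact: cst_continuous|exact: cf].
have gb x : 0 <= b - f x <= b.
  by case/andP: (fb x) => f0 fxb; rewrite subr_ge0 fxb gerBl.
have gE (P : probability (borel_rV R n) R) : \int[P]_x (b - f x) = b - \int[P]_x f x.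
  rewrite RintegralB//; first by rewrite Rintegral_cst//= [X in fine X](probability_setT P) mulr1.
    by apply: (@continuous_integrable _ _ _ _ `|b|); first exact: cst_continuous.
  apply: (@continuous_integrable _ _ _ _ b) => // x.
  by case/andP: (fb x) => *; rewrite ger0_norm.
have := integral_le_lim cg gb; rewrite gE.
have -> : lim ((fun k => \int[nu k]_x (b - f x)) @ U) = b - L.
  apply: cvg_lim => //; under eq_fun do rewrite gE.
  by apply: cvgB => //; exact: cvg_cst.
by rewrite lerD2l lerN2.
Qed.

Section double_integral.
Variables (f : V -> V -> R) (b : R).
Hypothesis fc : continuous (fun z : V * V => f z.1 z.2).
Hypothesis fb : forall x y, 0 <= f x y <= b.

Let fcx y : continuous (f^~ y).
Proof.
move=> x; apply: (@continuous_comp _ _ _ (fun x => (x, y)) (fun z => f z.1 z.2)).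
  move=> A [[B C] /= [nB nC] BC]; apply: filterS nB => z Bz.
  by apply: (BC (z, y)); split=> //; exact: nbhs_singleton.
exact: fc.
Qed.

Let tube (y0 : V) (e : R) : 0 < e ->
  \forall y \near y0, forall x, K x -> `|f x y - f x y0| <= e.
Proof.
move=> e0; move/compact_near_coveringP : Kc => /(_ V (nbhs y0)
  (fun y x => `|f x y - f x y0| <= e) _).
apply => x Kx.
have e20 : 0 < e / 2 by rewrite divr_gt0.
have /cvgrPdist_le /(_ _ e20) fxy := @fc (x, y0).
have [[A B] /= [nA nB] AB] := fxy.
exists (A, B) => // -[x' y] /= [Ax' By].
have h1 := AB (x', y) (conj Ax' By).
have h2 := AB (x', y0) (conj Ax' (nbhs_singleton nB)).
rewrite /= in h1 h2.
rewrite -(subrKA (f x y0)) [e]splitr (le_trans (ler_normD _ _))// lerD// distrC//.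
Qed.

Definition partial_integral (P : probability (borel_rV R n) R) (y : V) :=
  \int[P]_x f x y.

Lemma partial_integral_itv P y : 0 <= partial_integral P y <= b.
Proof. exact: Rintegral_itv. Qed.

Let normfb x y : `|f x y| <= b.
Proof. by case/andP: (fb x y) => *; rewrite ger0_norm. Qed.

(** The neighbourhood is independent of [P], since [tube] controls the integrand uniformly on [K],
    which carries every such [P]: the potentials are equicontinuous. *)
Let partial_integral_near (y0 : V) (e : R) : 0 < e -> \forall y \near y0,
  forall P : probability (borel_rV R n) R, P (~` K) = 0%E ->
  `|partial_integral P y - partial_integral P y0| <= e.
Proof.
move=> e0; have := tube y0 e0; apply: filterS => y fy P PK.
by apply: (@Rintegral_dist _ _ _ K _ _ b e).
Qed.

Lemma partial_integral_continuous P : P (~` K) = 0%E ->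
  continuous (partial_integral P).
Proof.
move=> PK y0; apply/(@cvgrPdist_le _ _ _ (nbhs (y0 : V)) _) => e e0.
have := partial_integral_near y0 e0; apply: filterS => y /(_ P PK).
by rewrite distrC.
Qed.

Definition double_integral (P : probability (borel_rV R n) R) :=
  \int[P]_y partial_integral P y.

(** The potentials of [nu k] converge pointwise to that of [m] and, being equicontinuous, uniformly
    on [K]; this costs [e / 4] for each of two equicontinuity errors and for the error at [y0]. The
    last [e / 4] comes from weak convergence tested on the continuous potential of [m]. *)
Lemma cvg_double_integral :
  (fun k => double_integral (nu k)) @ U --> double_integral m.
Proof.
have mK := weak_limit_compl.
have cm := partial_integral_continuous mK.
have bnd P y : `|partial_integral P y| <= b.
  by case/andP: (partial_integral_itv P y) => *; rewrite ger0_norm.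
apply/cvgrPdist_le => e e0.
have e40 : 0 < e / 4 by rewrite divr_gt0.
have unif : \forall k \near U, forall y, K y ->
    `|partial_integral (nu k) y - partial_integral m y| <= e / 4 + e / 4 + e / 4.
  move/compact_near_coveringP : Kc => /(_ nat U (fun k y =>
    `|partial_integral (nu k) y - partial_integral m y| <= e / 4 + e / 4 + e / 4) _).
  apply => y0 Ky0.
  have ny := partial_integral_near y0 e40.
  have /cvgrPdist_le /(_ _ e40) nk := cvg_integral (@fcx y0) (fb ^~ y0).
  exists ([set y | forall P : probability (borel_rV R n) R, P (~` K) = 0%E ->
  `|partial_integral P y - partial_integral P y0| <= e / 4],
    [set k | `|\int[m]_x f x y0 - \int[nu k]_x f x y0| <= e / 4]) => //.
  move=> [y k] /= [hy hk].
  have h1 := hy (nu k) (nuK k); have h2 := hy m mK.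
  rewrite (_ : _ - _ = (partial_integral (nu k) y - partial_integral (nu k) y0)
     + (partial_integral (nu k) y0 - partial_integral m y0)
     + (partial_integral m y0 - partial_integral m y)); last by lra.
  rewrite (le_trans (ler_normD _ _))// lerD//; last by rewrite distrC.
  by rewrite (le_trans (ler_normD _ _))// lerD// distrC.
have /cvgrPdist_le /(_ _ e40) := cvg_integral cm (partial_integral_itv m).
apply: filterS2 unif => k uk mk.
rewrite (_ : _ - _ = (\int[m]_y partial_integral m y - \int[nu k]_y partial_integral m y)
  + (\int[nu k]_y partial_integral m y - double_integral (nu k))); last first.
  by rewrite /double_integral; lra.
have -> : e = e / 4 + (e / 4 + e / 4 + e / 4) by lra.
rewrite (le_trans (ler_normD _ _))// lerD// distrC.
apply: (@Rintegral_dist _ _ _ K _ _ b) => //.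
exact: partial_integral_continuous.
Qed.

End double_integral.

End weak_convergence.

(** * Riesz energy *)

Section regularized_kernel.
Context {R : realType} {n : nat}.
Notation V := 'rV[R]_n.
Variable lam : R.
Hypothesis lam0 : 0 < lam.

(** The power [- lam] of the distance shifted by [1 / k.+1], written with [expR] and [ln] as the
    base is positive. The shift removes the singularity on the diagonal. *)
Definition reg_kernel (k : nat) (x y : V) : R :=
  expR (- lam * ln (enorm (x - y) + k.+1%:R^-1)).

Let base_gt0 k (x y : V) : 0 < enorm (x - y) + k.+1%:R^-1.
Proof. by rewrite ltr_wpDl ?enorm_ge0. Qed.

Lemma reg_kernel_gt0 k x y : 0 < reg_kernel k x y.
Proof. exact: expR_gt0. Qed.

Lemma reg_kernel_bound k x y :
  0 <= reg_kernel k x y <= expR (- lam * ln (k.+1%:R^-1)).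
Proof.
rewrite ltW ?reg_kernel_gt0//= ler_expR !mulNr lerN2 ler_pM2l//.
by rewrite ler_ln ?posrE// lerDr enorm_ge0.
Qed.

Lemma reg_kernel_continuous k :
  continuous (fun z : V * V => reg_kernel k z.1 z.2).
Proof.
move=> z; rewrite /reg_kernel.
apply: (@continuous_comp _ _ _
  (fun z : V * V => - lam * ln (enorm (z.1 - z.2) + k.+1%:R^-1)) expR).
  apply: (@continuousM _ _ (fun=> - lam)); first exact: cst_continuous.
  apply: (@continuous_comp (V * V)%type R R
    (fun z : V * V => enorm (z.1 - z.2) + k.+1%:R^-1) (@ln R)).
    apply: (@continuousD _ _ _ (fun z : V * V => enorm (z.1 - z.2)) (fun=> k.+1%:R^-1)).
      apply: (@continuous_comp _ _ _ (fun z : V * V => z.1 - z.2) enorm).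
        by apply: (@continuousB _ _ _ fst snd); [exact: cvg_fst|exact: cvg_snd].
      exact: enorm_continuous.
    exact: cst_continuous.
  exact: continuous_ln.
exact: continuous_expR.
Qed.

Lemma reg_kernel_nd x y j k : (j <= k)%N -> reg_kernel j x y <= reg_kernel k x y.
Proof.
move=> jk; rewrite ler_expR !mulNr lerN2 ler_pM2l// ler_ln ?posrE ?base_gt0//.
by rewrite lerD2l lef_pV2 ?posrE// ler_nat.
Qed.

Lemma reg_kernel_cvg x y :
  (reg_kernel k x y)%:E @[k --> \oo] --> riesz_kernel lam x y.
Proof.
rewrite /riesz_kernel; case: eqVneq => [->|xy].
  apply/cvgeyPge => A.
  (* On the diagonal the kernel is [k.+1] to the power [lam]. Past this threshold its logarithm is
     at least [A], and [1 + t <= expR t] transfers the bound to the kernel. *)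
  have := nbhs_infty_ger (expR (A / lam)); apply: filterS => k Ak.
  rewrite lee_fin /reg_kernel subrr enorm0 add0r lnV ?posrE// mulrN mulNr opprK.
  have ALn : A <= lam * ln k.+1%:R.
    rewrite mulrC -ler_pdivrMr// -(expRK (A / lam)) ler_ln ?posrE ?expR_gt0//.
    by rewrite (le_trans Ak)// ler_nat.
  by rewrite (le_trans ALn)// (le_trans _ (expR_ge1Dx _))// lerDr.
have e0 : 0 < enorm (x - y) by rewrite enorm_gt0 subr_eq0.
apply: cvg_EFin; first exact: nearW.
rewrite /powR gt_eqF//.
have cb : (fun k => enorm (x - y) + k.+1%:R^-1) @ \oo --> enorm (x - y).
  rewrite -[X in _ --> X]addr0; apply: cvgD; first exact: cvg_cst.
  exact: cvg_harmonic.
have cl := cvg_comp _ _ cb (continuous_ln e0).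
have cm := cvgM (@cvg_cst _ (- lam) nat \oo _) cl.
exact: (cvg_comp _ _ (cm _ _) (@continuous_expR R _)).
Qed.

Lemma reg_kernel_le k x y : ((reg_kernel k x y)%:E <= riesz_kernel lam x y)%E.
Proof.
have nd : {homo (fun k => (reg_kernel k x y)%:E) : i j / (i <= j)%N >-> (i <= j)%E}.
  by move=> i j ij; rewrite lee_fin reg_kernel_nd.
rewrite -(cvg_lim _ (@reg_kernel_cvg x y))// (cvg_lim _ (ereal_nondecreasing_cvgn nd))//.
by apply: ereal_sup_ubound; exists k.
Qed.

Lemma riesz_kernel_ge0 (x y : V) : (0 <= riesz_kernel lam x y)%E.
Proof. by apply: le_trans (reg_kernel_le 0 x y); rewrite lee_fin ltW// reg_kernel_gt0. Qed.

Lemma riesz_energy_ge0 (P : probability (borel_rV R n) R) : (0 <= riesz_energy lam P)%E.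
Proof.
by apply: integral_ge0 => y _; apply: integral_ge0 => x _; exact: riesz_kernel_ge0.
Qed.

Definition reg_energy k := double_integral (reg_kernel k).

Let slice_continuous k y : continuous (reg_kernel k ^~ y).
Proof.
move=> x; apply: (@continuous_comp _ _ _ (fun x => (x, y)) (fun z => reg_kernel k z.1 z.2)).
  move=> A [[B C] /= [nB nC] BC]; apply: filterS nB => z Bz.
  by apply: (BC (z, y)); split=> //; exact: nbhs_singleton.
exact: reg_kernel_continuous.
Qed.

Lemma measurable_riesz_kernel y : measurable_fun [set: borel_rV R n] (riesz_kernel lam ^~ y).
Proof.
apply: (@emeasurable_fun_cvg _ (borel_rV R n) R setT
  (fun k x => (reg_kernel k x y)%:E) (riesz_kernel lam ^~ y)) => [k|x _].
  by apply: measurableT_comp => //; apply: continuous_borel; exact: slice_continuous.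
exact: reg_kernel_cvg.
Qed.

Section compact_support.
Variables (K : set V) (P : probability (borel_rV R n) R).
Hypotheses (Kc : compact K) (PK : P (~` K) = 0%E).

Let partialE k y : (partial_integral (reg_kernel k) P y)%:E =
  (\int[P]_x (reg_kernel k x y)%:E)%E.
Proof.
rewrite /partial_integral /Rintegral fineK//.
apply: (integrable_fin_num measurableT).
apply: (@continuous_integrable _ _ _ _ (expR (- lam * ln (k.+1%:R^-1)))).
  exact: slice_continuous.
by move=> x; case/andP: (reg_kernel_bound k x y) => *; rewrite ger0_norm.
Qed.

Let partial_continuous k : continuous (partial_integral (reg_kernel k) P).
Proof.
exact: (partial_integral_continuous Kc (@reg_kernel_continuous k) (reg_kernel_bound k) PK).
Qed.

Let partial_nd y : {homo (fun k => (partial_integral (reg_kernel k) P y)%:E) :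
  i j / (i <= j)%N >-> (i <= j)%E}.
Proof.
move=> i j ij; rewrite !partialE; apply: ge0_le_integral => //.
- by move=> x _; rewrite lee_fin ltW// reg_kernel_gt0.
- by apply: measurableT_comp => //; apply: continuous_borel; exact: slice_continuous.
- by apply: measurableT_comp => //; apply: continuous_borel; exact: slice_continuous.
- by move=> x _; rewrite lee_fin reg_kernel_nd.
Qed.

Let partial_cvg y : (partial_integral (reg_kernel k) P y)%:E @[k --> \oo] -->
  (\int[P]_x riesz_kernel lam x y)%E.
Proof.
under eq_fun do rewrite partialE.
rewrite (_ : (fun x => riesz_kernel lam x y) =
  (fun x => limn (fun k => (reg_kernel k x y)%:E))).
  apply: cvg_monotone_convergence => //.
  - by move=> k; apply: measurableT_comp => //; apply: continuous_borel; exact: slice_continuous.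
  - by move=> k x _; rewrite lee_fin ltW// reg_kernel_gt0.
  - by move=> x _ i j ij; rewrite lee_fin reg_kernel_nd.
by apply/funext => x; rewrite (cvg_lim _ (@reg_kernel_cvg x y)).
Qed.

(** A pointwise limit of the regularized potentials, whose continuity comes from the compact set [K]
    carrying [P]. *)
Lemma measurable_potential :
  measurable_fun [set: borel_rV R n] (fun y => \int[P]_x riesz_kernel lam x y)%E.
Proof.
apply: (@emeasurable_fun_cvg _ (borel_rV R n) R setT
  (fun k y => (partial_integral (reg_kernel k) P y)%:E)
  (fun y => \int[P]_x riesz_kernel lam x y)%E) => [k|y _].
  by apply: measurableT_comp => //; apply: continuous_borel; exact: partial_continuous.
exact: partial_cvg.
Qed.

Let reg_energyE k : (reg_energy k P)%:E =
  (\int[P]_y (partial_integral (reg_kernel k) P y)%:E)%E.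
Proof.
rewrite /reg_energy /double_integral /Rintegral fineK//.
apply: (integrable_fin_num measurableT).
apply: (@continuous_integrable _ _ _ _ (expR (- lam * ln (k.+1%:R^-1)))).
  exact: partial_continuous.
move=> y; have := partial_integral_itv (@reg_kernel_continuous k) (reg_kernel_bound k) P y.
by case/andP => *; rewrite ger0_norm.
Qed.

Let partial_ge0 k y : (0 <= (partial_integral (reg_kernel k) P y)%:E)%E.
Proof.
by rewrite partialE; apply: integral_ge0 => x _; rewrite lee_fin ltW// reg_kernel_gt0.
Qed.

Lemma reg_energy_cvg : (reg_energy k P)%:E @[k --> \oo] --> riesz_energy lam P.
Proof.
under eq_fun do rewrite reg_energyE.
rewrite /riesz_energy.
rewrite (_ : (fun y => \int[P]_x riesz_kernel lam x y)%E =
  (fun y => limn (fun k => (partial_integral (reg_kernel k) P y)%:E))).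
  apply: cvg_monotone_convergence => //.
  - by move=> k; apply: measurableT_comp => //; apply: continuous_borel; exact: partial_continuous.
by apply/funext => y; rewrite (cvg_lim _ (@partial_cvg y)).
Qed.

Lemma reg_energy_le k : ((reg_energy k P)%:E <= riesz_energy lam P)%E.
Proof.
have nd : {homo (fun k => (reg_energy k P)%:E) : i j / (i <= j)%N >-> (i <= j)%E}.
  move=> i j ij; rewrite [leRHS]reg_energyE [leLHS]reg_energyE.
  apply: ge0_le_integral => //.
  - by apply: measurableT_comp => //; apply: continuous_borel; exact: partial_continuous.
  - by apply: measurableT_comp => //; apply: continuous_borel; exact: partial_continuous.
  - by move=> y _; exact: partial_nd.
have -> : riesz_energy lam P = ereal_sup (range (fun k => (reg_energy k P)%:E)).
  exact: (cvg_unique _ reg_energy_cvg (ereal_nondecreasing_cvgn nd)).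
by apply: ereal_sup_ubound; exists k.
Qed.

Lemma riesz_energy_gt0 : (0 < riesz_energy lam P)%E.
Proof.
have pos (f : V -> \bar R) : measurable_fun [set: borel_rV R n] f ->
    (forall x, 0 < f x)%E -> (0 < \int[P]_x f x)%E.
  move=> mf f0; rewrite lt_def integral_ge0 ?andbT; last by move=> x _; exact: ltW.
  apply/eqP => If0.
  have : (\int[P]_x `|f x|)%E = 0%E.
    by rewrite -[RHS]If0; apply: eq_integral => x _; rewrite gee0_abs// ltW.
  move/(ae_eq_integral_abs _ measurableT mf) => [N [mN PN NE]].
  have : P setT = 0%E.
    rewrite -PN; congr (P _); apply/seteqP; split=> // x _; apply: NE => /= /(_ I) fx.
    by have := f0 x; rewrite fx ltxx.
  by rewrite probability_setT => -[] /eqP; rewrite oner_eq0.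
apply: (pos _); first exact: measurable_potential.
move=> y; apply: (pos _); first exact: measurable_riesz_kernel.
by move=> x; apply: lt_le_trans (reg_kernel_le 0 x y); rewrite lte_fin reg_kernel_gt0.
Qed.

End compact_support.

(** For fixed [j] the regularized energies converge along [U] and are at most the Riesz energies,
    hence eventually at most [c + e]; then [e] tends to 0 and [j] to infinity. *)
Lemma riesz_energy_lsc (U : set_system nat) (UU : UltraFilter U)
  (nu : nat -> probability (borel_rV R n) R) (K : set V)
  (m : probability (borel_rV R n) R) (c : \bar R) :
  compact K -> (forall k, nu k (~` K) = 0%E) ->
  (forall O, open O -> (m O <= (lim ((fun k => fine (nu k O)) @ U))%:E)%E) ->
  (0 <= c)%E ->
  (forall e, 0 < e -> \forall k \near U, (riesz_energy lam (nu k) <= c + e%:E)%E) ->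
  (riesz_energy lam m <= c)%E.
Proof.
move=> Kc nuK num c0 nuc.
have mK := weak_limit_compl UU Kc nuK num.
have cv := reg_energy_cvg Kc mK.
have <- : lim ((reg_energy k m)%:E @[k --> \oo]) = riesz_energy lam m.
  exact: cvg_lim cv.
apply: lime_le; first by apply/cvg_ex; exists (riesz_energy lam m).
apply: nearW => j; case: c c0 nuc => [c _|_|//] nuc; last by rewrite leey.
apply/lee_addgt0Pr => e e0; rewrite -EFinD lee_fin.
have cvj := cvg_double_integral UU Kc nuK num (@reg_kernel_continuous j) (reg_kernel_bound j).
apply: (@ultra_ler_lim _ U UU (fun k => reg_energy j (nu k)) (fun=> c + e)) => //.
  exact: cvg_cst.
apply: filterS (nuc e e0) => k nuk.
by rewrite -lee_fin EFinD (le_trans _ nuk)// (reg_energy_le Kc (nuK k)).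
Qed.

End regularized_kernel.

(** * The support of a Borel probability measure *)

Section support.
Context {R : realType} {n : nat}.
Notation V := 'rV[R]_n.
Implicit Types (P : probability (borel_rV R n) R) (K A : set V).

Let subset_null P A B : open A -> open B -> A `<=` B -> P B = 0%E -> P A = 0%E.
Proof.
move=> oA oB AB PB; apply/eqP; rewrite eq_le measure_ge0 andbT -PB.
by apply: le_measure => //; rewrite inE; exact: borel_open.
Qed.

Lemma closed_supp P : closed (supp P).
Proof.
move=> x clx B oB Bx.
have [y [sy By]] := clx B (open_nbhs_nbhs (conj oB Bx)).
exact: sy.
Qed.

(* Near covering of a compact set along the directed family of null open sets. *)
Let compact_null P K : compact K -> K `<=` ~` supp P ->
  exists W, [/\ open W, P W = 0%E & K `<=` W].
Proof.
move=> /compact_near_coveringP cK Ksupp.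
pose null := [set W : set V | open W /\ P W = 0%E].
pose F := filter_from null (fun W => [set W' | null W' /\ W `<=` W']).
have FF : Filter F.
  apply: filter_from_filter.
    by exists set0; split; [exact: open0|exact: measure0].
  move=> A B [oA PA] [oB PB]; exists (A `|` B).
    split; first exact: openU.
    apply/eqP; rewrite eq_le measure_ge0 andbT.
    have := measureU2 P (borel_open oA) (borel_open oB).
    by rewrite [X in (_ <= X + _)%E]PA [X in (_ <= _ + X)%E]PB adde0.
  by move=> W [nW ABW]; split; split=> // x ?; apply: ABW; [left|right].
have [|W nW] := cK _ F (fun W x => W x) FF.
  move=> x /Ksupp nsx.
  have [B [oB Bx PB]] : exists B, [/\ open B, B x & P B = 0%E].
    apply: contrapT => nB; apply: nsx => B oB Bx.
    by rewrite lt_def measure_ge0 andbT; apply/eqP => PB; apply: nB; exists B.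
  exists (B, [set W' | null W' /\ B `<=` W']) => /=.
    by split; [exact: open_nbhs_nbhs|exists B].
  by move=> [y W] /= [By [_ BW]]; exact: BW.
move=> /(_ W (conj nW (@subset_refl _ W))) KW.
by case: nW => oW PW; exists W.
Qed.

(** The open complement of the support is exhausted by the compact sets [C k], closures of erosions
    cut off by balls. Each is null by [compact_null], and countable subadditivity concludes. *)
Lemma suppC_null P : P (~` supp P) = 0%E.
Proof.
set H := ~` supp P.
have oH : open H by apply: closed_openC; exact: closed_supp.
pose C k : set V := [set x | enorm x <= k%:R] `&` closure (inner_set k.+1%:R^-1 H).
have cC k : compact (C k).
  by apply: compact_closedI; [exact: compact_eball|exact: closed_closure].
have CH k : C k `<=` H.
  by move=> x [_]; apply: closure_inner_set.
have PC k : P (C k) = 0%E.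
  have [W [oW PW CW]] := compact_null (cC k) (@CH k).
  apply/eqP; rewrite eq_le measure_ge0 andbT -PW.
  by apply: le_measure => //; rewrite inE; [exact: borel_compact|exact: borel_open].
apply/eqP; rewrite eq_le measure_ge0 andbT.
apply: le_trans (measure_sigma_subadditive P
  (fun k => borel_compact (cC k)) (borel_open oH) _) _.
  move=> x Hx.
  have [[A N] /= [nA nN] AN] := inner_set_near oH Hx.
  have [k [Nk xk]] : exists k, N k /\ enorm x <= k%:R.
    exact: (filter_ex (filterI nN (nbhs_infty_ger (enorm x)))).
  exists k => //; split=> //; apply: subset_closure.
  by apply: (AN (x, k)); split=> //; exact: nbhs_singleton.
by rewrite eseries0// => k _ _; exact: PC.
Qed.

Lemma supp_nonempty P : supp P !=set0.
Proof.
apply/set0P/eqP => s0; have := suppC_null P; rewrite s0 setC0.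
by rewrite probability_setT => -[] /eqP; rewrite oner_eq0.
Qed.

Lemma supp_subset P K : closed K -> (supp P `<=` K) <-> P (~` K) = 0%E.
Proof.
move=> cK; have oK : open (~` K) by exact: closed_openC.
split=> [sK|PK x sx].
  apply: (@subset_null _ _ (~` supp P)) => //; first exact: closed_openC (@closed_supp P).
    exact: subsetC.
  exact: suppC_null.
by apply: contrapT => nKx; have := sx _ oK nKx; rewrite PK ltxx.
Qed.

Lemma supp_meet P B : open B -> (0 < P B)%E -> supp P `&` B !=set0.
Proof.
move=> oB PB; apply/set0P/eqP => sB.
have oS : open (~` supp P) by apply: closed_openC; exact: closed_supp.
have : P B = 0%E.
  apply: (subset_null oB oS _ (suppC_null P)) => x Bx sx.
  by have : (supp P `&` B) x by []; rewrite sB.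
by move=> PB0; rewrite PB0 ltxx in PB.
Qed.

Lemma dirac_rVE (a : V) A :
  (dirac (a : borel_rV R n) : probability (borel_rV R n) R) A = (a \in A)%:R%:E.
Proof. by rewrite [LHS](_ : _ = (\1_A a : R)%:E)// indicE. Qed.

Lemma supp_dirac_subset (a : V) K : K a -> closed K ->
  supp (dirac (a : borel_rV R n) : probability (borel_rV R n) R) `<=` K.
Proof.
by move=> Ka cK; apply/(supp_subset _ cK); rewrite dirac_rVE memNset.
Qed.

End support.

(** * Energy and support under translations and dilations *)

Section affine_image.
Context {R : realType} {n : nat}.
Notation V := 'rV[R]_n.
Implicit Types P Q : probability (borel_rV R n) R.
Variable lam : R.
Hypothesis lam0 : 0 < lam.

Lemma riesz_kernel_affine (c : R) (a x y : V) : 0 < c ->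
  riesz_kernel lam (c *: x + a) (c *: y + a) =
  ((c `^ (- lam))%:E * riesz_kernel lam x y)%E.
Proof.
move=> c0; rewrite /riesz_kernel.
have -> : (c *: x + a == c *: y + a) = (x == y).
  by rewrite (inj_eq (addIr a)) (inj_eq (scalerI _))// gt_eqF.
case: eqVneq => [_|xy]; first by rewrite gt0_muley// lte_fin powR_gt0.
have -> : c *: x + a - (c *: y + a) = c *: (x - y).
  by rewrite scalerBr opprD addrACA subrr addr0.
by rewrite enormZ gtr0_norm// powRM ?enorm_ge0 ?ltW// EFinM.
Qed.

Lemma affine_image (c : R) (a : V) P K : 0 < c -> compact K -> P (~` K) = 0%E ->
  exists Q, supp Q `<=` [set c *: x + a | x in supp P] /\
    riesz_energy lam Q = ((c `^ (- lam))%:E * riesz_energy lam P)%E.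
Proof.
move=> c0 cK PK.
pose T (x : V) := c *: x + a.
pose T' (z : V) := c^-1 *: (z - a).
have cT : continuous T.
  move=> x; apply: (@continuousD _ _ _ (fun x => c *: x) (fun=> a)).
    exact: scaler_continuous.
  exact: cst_continuous.
have cT' : continuous T'.
  move=> z; apply: (@continuous_comp _ _ _ (fun z : V => z - a) (fun x => c^-1 *: x)).
    by apply: (@continuousB _ _ _ id (fun=> a)); [exact: cvg_id|exact: cst_continuous].
  exact: scaler_continuous.
have TK : cancel T T' by move=> x; rewrite /T' /T addrK scalerK// gt_eqF.
have T'K : cancel T' T by move=> x; rewrite /T' /T scalerKV ?gt_eqF// subrK.
have mT : @measurable_fun _ _ (borel_rV R n) (borel_rV R n) setT T.
  apply: (@measurability _ _ (borel_rV R n) (borel_rV R n) setT T (@open V))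
    => // _ [B oB <-].
  by rewrite setTI; apply: borel_open; apply: open_comp oB => x _; exact: cT.
pose X : {mfun borel_rV R n >-> borel_rV R n} :=
  HB.pack (T : borel_rV R n -> borel_rV R n)
      (isMeasurableFun.Build _ _ (borel_rV R n) (borel_rV R n) T mT).
pose Q : probability (borel_rV R n) R := distribution P X.
have QE B : Q B = P (T @^-1` B) by [].
exists Q; split.
  move=> z sz; exists (T' z); last exact: T'K.
  move=> B oB BT'z.
  have oT'B : open (T' @^-1` B) by apply: open_comp oB => x _; exact: cT'.
  have := sz _ oT'B BT'z; rewrite QE (_ : T @^-1` _ = B)//.
  by apply/seteqP; split=> x /=; rewrite TK.
have cTK : compact (T @` K).
  by apply: continuous_compact => //; exact: continuous_subspaceT.
have QTK : Q (~` (T @` K)) = 0%E.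
  apply/eqP; rewrite eq_le measure_ge0 andbT QE -PK.
  have oK : open (~` K).
    by apply: closed_openC; apply: compact_closed => //; exact: norm_hausdorff.
  have oTK : open (~` (T @` K)).
    by apply: closed_openC; apply: compact_closed => //; exact: norm_hausdorff.
  apply: le_measure; rewrite ?inE.
  - by apply: borel_open; apply: open_comp oTK => x _; exact: cT.
  - exact: borel_open.
  - by move=> x /= nTx Kx; apply: nTx; exists x.
have cl : (0 <= (c `^ (- lam))%:E)%E by rewrite lee_fin powR_ge0.
rewrite /riesz_energy ge0_integral_distribution; last 2 first.
- exact: measurable_potential cTK QTK.
- by move=> y; apply: integral_ge0 => x _; exact: riesz_kernel_ge0.
rewrite -ge0_integralZl//; last 2 first.
- exact: measurable_potential cK PK.
- by move=> y _; apply: integral_ge0 => x _; exact: riesz_kernel_ge0.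
apply: eq_integral => y _ /=.
rewrite ge0_integral_distribution; last 2 first.
- exact: measurable_riesz_kernel.
- by move=> x; exact: riesz_kernel_ge0.
rewrite -ge0_integralZl//; last 2 first.
- exact: measurable_riesz_kernel.
- by move=> x _; exact: riesz_kernel_ge0.
by apply: eq_integral => x _ /=; exact: riesz_kernel_affine.
Qed.

Lemma affine_image_diam (c d : R) (a : V) P Q : 0 < c ->
  supp Q `<=` [set c *: x + a | x in supp P] -> (diam (supp P) <= d%:E)%E ->
  (diam (supp Q) <= (c * d)%:E)%E.
Proof.
move=> c0 sQ /diam_leP dP; apply/diam_leP => _ _ /sQ[x sx <-] /sQ[y sy <-].
rewrite opprD addrACA subrr addr0 -scalerBr enormZ gtr0_norm//.
by rewrite ler_pM2l// dP.
Qed.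

End affine_image.

(** * Existence and diameter of minimizers, and capacity *)

Section minimizers.
Context {R : realType} {n : nat}.
Notation V := 'rV[R]_n.
Implicit Types P Q mu : probability (borel_rV R n) R.
Implicit Types W : set V.
Variable lam : R.
Hypothesis lam0 : 0 < lam.

(** The weak inequality covers an infinite infimum as well, where any element will do. *)
Lemma ereal_inf_approx (S : set (\bar R)) (e : R) : 0 < e -> S !=set0 ->
  (0 <= ereal_inf S)%E -> exists2 x, S x & (x <= ereal_inf S + e%:E)%E.
Proof.
move=> e0 [x Sx] i0; have [i_fin|] := boolP (ereal_inf S \is a fin_num).
  by have [y Sy /ltW] := lb_ereal_inf_adherent e0 i_fin; exists y.
by rewrite ge0_fin_numE// -leNgt leye_eq => /eqP ->; exists x => //; rewrite leey.
Qed.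

(** The last clause is what remains of weak convergence once the filter is forgotten. It compares
    pairs of open sets, since a bound on the diameter is a condition on pairs of points of the
    support. *)
Lemma energy_compactness (nu : nat -> probability (borel_rV R n) R) (K : set V)
    (c : \bar R) :
  compact K -> (forall k, nu k (~` K) = 0%E) -> (0 <= c)%E ->
  (forall k, (riesz_energy lam (nu k) <= c + (k.+1%:R^-1)%:E)%E) ->
  exists m : probability (borel_rV R n) R,
    [/\ m (~` K) = 0%E, (riesz_energy lam m <= c)%E &
      forall A B : set V, open A -> open B -> (0 < m A)%E -> (0 < m B)%E ->
      exists k, (0 < nu k A)%E /\ (0 < nu k B)%E].
Proof.
move=> cK nuK c0 nuc.
have [U [UU oU]] := @ultraFilterLemma nat \oo _.
have [m num] := weak_limit_exists UU cK nuK.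
exists m; split.
- exact: weak_limit_compl num.
- apply: (riesz_energy_lsc lam0 UU cK nuK num c0) => e e0; apply: oU.
  have := near_infty_natSinv_lt (PosNum e0); apply: filterS => k /= ke.
  by rewrite (le_trans (nuc k))// leeD2l// lee_fin ltW.
- move=> A B oA oB mA mB.
  have nA := weak_limit_gt0 UU num oA mA; have nB := weak_limit_gt0 UU num oB mB.
  by have [k []] := filter_ex (filterI nA nB); exists k.
Qed.

Lemma equilibrium_measure_exists W : compact W -> W !=set0 ->
  exists mu : probability (borel_rV R n) R, equilibrium_measure lam W mu.
Proof.
move=> cW [a Wa]; set c := min_riesz_energy lam W.
have clW : closed W by apply: compact_closed => //; exact: norm_hausdorff.
have c0 : (0 <= c)%E.
  by apply: le_ereal_inf_tmp => _ [P _ <-]; exact: riesz_energy_ge0.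
have W0 : [set riesz_energy lam nu | nu in [set nu | supp nu `<=` W]] !=set0.
  by eexists; exists (dirac (a : borel_rV R n)) => //; exact: supp_dirac_subset.
have /choice[nu nuP] k : exists P : probability (borel_rV R n) R,
    supp P `<=` W /\ (riesz_energy lam P <= c + (k.+1%:R^-1)%:E)%E.
  have k0 : 0 < (k.+1%:R^-1 : R) by [].
  by have [_ [P PW <-] Pc] := ereal_inf_approx k0 W0 c0; exists P.
have nuW k : nu k (~` W) = 0%E by apply/supp_subset => //; case: (nuP k).
have [mu [muW muc _]] := energy_compactness cW nuW c0 (fun k => (nuP k).2).
have sW : supp mu `<=` W by apply/supp_subset.
exists mu; split=> //; apply/eqP; rewrite eq_le muc/=.
by apply: ereal_inf_lbound; exists mu.
Qed.

Let minE : \bar R :=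
  ereal_inf [set energy_infty lam nu | nu in [set: probability (borel_rV R n) R]].
Let maxC : \bar R :=
  ereal_sup [set capacity lam A | A in [set A : set V | (diam A <= 1)%E]].

Let energy_infty_ge0 P : (0 <= energy_infty lam P)%E.
Proof. by rewrite /energy_infty; case: ifP => // _; exact: riesz_energy_ge0. Qed.

Let minE_ge0 : (0 <= minE)%E.
Proof. by apply: le_ereal_inf_tmp => _ [P _ <-]. Qed.

Lemma energy_inftyE P : (diam (supp P) <= 1)%E ->
  energy_infty lam P = riesz_energy lam P.
Proof. by rewrite /energy_infty => ->. Qed.

Let minE_le P : (minE <= energy_infty lam P)%E.
Proof. by apply: ereal_inf_lbound; exists P. Qed.

Let min_riesz_energy_ge0 (A : set V) : (0 <= min_riesz_energy lam A)%E.
Proof. by apply: le_ereal_inf_tmp => _ [P _ <-]; exact: riesz_energy_ge0. Qed.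

Let minE_le_min_riesz_energy (A : set V) : (diam A <= 1)%E ->
  (minE <= min_riesz_energy lam A)%E.
Proof.
move=> dA; apply: le_ereal_inf_tmp => _ [P PA <-].
by rewrite -energy_inftyE// (le_trans _ dA)// diam_le.
Qed.

Lemma max_capacityE : maxC = (minE^-1)%E.
Proof.
apply/eqP; rewrite eq_le; apply/andP; split.
  apply: ge_ereal_sup => _ [A dA <-].
  by rewrite lee_pV2 ?inE//; exact: minE_le_min_riesz_energy.
(* The inverse is order-reversing on nonnegative values; the empty set, an admissible [A], shows
   that [maxC] is one. *)
have maxC0 : (0 <= maxC)%E.
  apply: (@le_trans _ _ (capacity lam set0)); first by rewrite inve_ge0.
  apply: ereal_sup_ubound; exists set0 => //.
  by apply: (@diam_leP _ _ set0 1).2.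
rewrite -[leRHS]inveK lee_pV2 ?inE ?inve_ge0//.
apply: le_ereal_inf_tmp => _ [P _ <-]; rewrite /energy_infty.
case: ifPn => [dP|_]; last by rewrite leey.
rewrite -[leRHS]inveK lee_pV2 ?inE ?inve_ge0//; last exact: riesz_energy_ge0.
apply: (@le_trans _ _ (capacity lam (supp P))); last first.
  by apply: ereal_sup_ubound; exists (supp P).
rewrite lee_pV2 ?inE//; last exact: riesz_energy_ge0.
by apply: ereal_inf_lbound; exists P.
Qed.

Let small_supp_compact P : (diam (supp P) <= 1)%E ->
  exists2 K : set V, compact K & P (~` K) = 0%E.
Proof.
move=> /diam_leP dP; have [p sp] := supp_nonempty P.
exists [set x | enorm x <= 1 + enorm p]; first exact: compact_eball.
apply/supp_subset; first by apply: compact_closed; [exact: norm_hausdorff|exact: compact_eball].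
move=> x sx; rewrite /= -[x in enorm x](subrK p) (le_trans (ler_enormD _ _))//.
by rewrite lerD2r dP.
Qed.

Lemma minimizer_exists : (minE < +oo)%E ->
  exists mu : probability (borel_rV R n) R, (diam (supp mu) <= 1)%E /\ riesz_energy lam mu = minE.
Proof.
move=> minEy; pose K := [set x : V | enorm x <= 1].
have cK : compact K by exact: compact_eball.
have S0 : [set energy_infty lam nu | nu in [set: probability (borel_rV R n) R]] !=set0.
  by eexists; exists (dirac (0 : borel_rV R n)).
have /choice[nu nuP] k : exists P, [/\ supp P `<=` K, (diam (supp P) <= 1)%E &
    (riesz_energy lam P <= minE + (k.+1%:R^-1)%:E)%E].
  have k0 : 0 < (k.+1%:R^-1 : R) by [].
  have [_ [P _ <-] Pc] := ereal_inf_approx k0 S0 minE_ge0.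
  (* A larger diameter would make [energy_infty] infinite, whereas near-minimizers have finite
     energy by [minEy]. *)
  have dP : (diam (supp P) <= 1)%E.
    have : (energy_infty lam P < +oo)%E.
      by rewrite (le_lt_trans Pc)// lte_add_pinfty ?ltry.
    by rewrite /energy_infty; case: ifP.
  rewrite energy_inftyE// in Pc.
  have [K' cK' PK'] := small_supp_compact dP.
  have [p sp] := supp_nonempty P.
  have [Q [sQ IQ]] := affine_image lam0 (- p) (@ltr01 R) cK' PK'.
  exists Q; split.
  - move=> _ /sQ[x sx <-]; rewrite /K /= scale1r.
    by move/diam_leP : dP; apply.
  - by have := affine_image_diam (@ltr01 R) sQ dP; rewrite mul1r.
  - by rewrite IQ powR1 mul1e.
have clK : closed K by apply: compact_closed => //; exact: norm_hausdorff.
have nuK k : nu k (~` K) = 0%E by apply/supp_subset => //; case: (nuP k).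
have nuE k : (riesz_energy lam (nu k) <= minE + (k.+1%:R^-1)%:E)%E by case: (nuP k).
have [mu [muK muE mup]] := energy_compactness cK nuK minE_ge0 nuE.
have dmu : (diam (supp mu) <= 1)%E.
  (* Two support points more than 1 apart have neighbourhoods [A] and [B] all of whose pairs are
     more than 1 apart. Some [nu k] charges both, so its support meets both, against its diameter
     bound. *)
  apply/diam_leP => x y sx sy; rewrite leNgt; apply/negP => xy.
  have cf : continuous (fun z : V * V => enorm (z.1 - z.2)).
    move=> z; apply: (@continuous_comp _ _ _ (fun z : V * V => z.1 - z.2) enorm).
      by apply: (@continuousB _ _ _ fst snd); [exact: cvg_fst|exact: cvg_snd].
    exact: enorm_continuous.
  have := @cvgr_gt _ _ _ _ _ _ (@cf (x, y)) _ xy.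
  move=> [[A B] /= [nA nB] AB].
  have oA := open_interior A; have oB := open_interior B.
  have [k [kA kB]] := mup _ _ oA oB (sx _ oA nA) (sy _ oB nB).
  have [u [su /interior_subset Au]] := supp_meet oA kA.
  have [v [sv /interior_subset Bv]] := supp_meet oB kB.
  have := AB (u, v) (conj Au Bv); rewrite /= ltNge => /negP; apply.
  by case: (nuP k) => _ /diam_leP + _; apply.
exists mu; split=> //; apply/eqP; rewrite eq_le muE/=.
by rewrite -energy_inftyE.
Qed.

(* Dilating a measure of smaller diameter would lower its energy. *)
Lemma minimizer_diam mu : (minE < +oo)%E -> (diam (supp mu) <= 1)%E ->
  riesz_energy lam mu = minE -> diam (supp mu) = 1%E.
Proof.
move=> minEy dmu muE; apply/eqP; rewrite eq_le dmu/= leNgt; apply/negP => dmu1.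
have [d dE d0] : exists2 d, diam (supp mu) = d%:E & 0 <= d.
  have [p sp] := supp_nonempty mu.
  have d0 : (0 <= diam (supp mu))%E.
    by apply: ereal_sup_ubound; exists p => //; exists p => //; rewrite subrr enorm0.
  exists (fine (diam (supp mu))); last by rewrite fine_ge0.
  by rewrite fineK// ge0_fin_numE// (lt_trans dmu1)// ltry.
move: dmu1; rewrite dE lte_fin => d1.
(* For [0 <= d < 1] this gives [c > 1] and [c * d <= 1]; unlike [1 / d] it also handles [d = 0], a
   support reduced to a point. *)
pose c := 2 / (1 + d).
have c1 : 1 < c by rewrite ltr_pdivlMr; lra.
have c0 : 0 < c by rewrite (lt_trans _ c1).
have [K cK muK] := small_supp_compact dmu.
have [Q [sQ IQ]] := affine_image lam0 0 c0 cK muK.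
have dmud : (diam (supp mu) <= d%:E)%E by rewrite dE.
have dQ : (diam (supp Q) <= 1)%E.
  rewrite (le_trans (affine_image_diam c0 sQ dmud))// lee_fin /c mulrAC.
  by rewrite ler_pdivrMr; lra.
have := minE_le Q; rewrite energy_inftyE// IQ muE leNgt => /negP; apply.
have minE0 : (0 < minE)%E by rewrite -muE (riesz_energy_gt0 lam0 cK muK).
have /fineK <- : minE \is a fin_num by rewrite ge0_fin_numE.
have f0 : 0 < fine minE by rewrite fine_gt0// minE0.
rewrite -EFinM lte_fin gtr_pMl// powRN invf_lt1 ?powR_gt0//.
by rewrite /powR gt_eqF// expR_gt1 mulr_gt0// ln_gt0.
Qed.

Lemma diam1_measure_exists : (0 < n)%N ->
  exists mu : probability (borel_rV R n) R, diam (supp mu) = 1%E.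
Proof.
move=> n0; pose u : V := const_mx 1.
have u0 : u != 0.
  apply/eqP => /matrixP/(_ ord0 (Ordinal n0)); rewrite !mxE => /eqP.
  by rewrite oner_eq0.
have [e e1] : exists e : V, enorm e = 1.
  exists ((enorm u)^-1 *: u).
  by rewrite enormZ ger0_norm ?invr_ge0 ?enorm_ge0// mulVf// gt_eqF// enorm_gt0.
pose d0 : probability (borel_rV R n) R := dirac (0 : borel_rV R n).
pose d1 : probability (borel_rV R n) R := dirac (e : borel_rV R n).
pose m : {measure set (borel_rV R n) -> \bar R} := measure_add d0 d1.
have mE A : m A = (d0 A + d1 A)%E by exact: measure_addE.
have mT : m setT = 2%:E.
  by rewrite mE [X in (X + _)%E](probability_setT d0)
    [X in (_ + X)%E](probability_setT d1) -EFinD.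
(* The second argument of [mnormalize] is a default for total mass 0 or infinity; here the mass is
   2. *)
pose mu : probability (borel_rV R n) R := mnormalize m d0.
have muE A : mu A = (m A * (2^-1)%:E)%E.
  by rewrite /mu/= /mnormalize mT/= eqe (_ : (2 : R) == 0 = false)//; exact/negbTE.
pose S := [set x : V | x = 0 \/ x = e].
have clS : closed S.
  rewrite (_ : S = [set 0] `|` [set e]); last by apply/seteqP; split.
  by apply: closedU; apply: compact_closed; try exact: compact_set1; exact: norm_hausdorff.
have sS : supp mu `<=` S.
  apply/supp_subset => //; rewrite muE mE.
  rewrite [X in (X + _)%E](_ : _ = 0%E); last first.
    by rewrite dirac_rVE memNset// => -[]; left.
  rewrite [X in (_ + X)%E](_ : _ = 0%E) ?adde0 ?mul0e//.
  by rewrite dirac_rVE memNset// => -[]; right.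
have pos x B : (x = 0 \/ x = e) -> B x -> (0 < mu B)%E.
  move=> xE Bx; rewrite muE mule_gt0 ?lte_fin//.
  rewrite mE; case: xE Bx => -> Bx.
    apply: (@lt_le_trans _ _ (d0 B)); last exact: leeDl.
    by rewrite dirac_rVE mem_set// lte_fin.
  apply: (@lt_le_trans _ _ (d1 B)); last exact: leeDr.
  by rewrite dirac_rVE mem_set// lte_fin.
exists mu; apply/eqP; rewrite eq_le; apply/andP; split.
  apply/diam_leP => x y /sS[]-> /sS[]->.
  - by rewrite subrr enorm0.
  - by rewrite sub0r enormN e1.
  - by rewrite subr0 e1.
  - by rewrite subrr enorm0.
apply: ereal_sup_ubound; exists e; first by move=> B _ Be; apply: (pos e) => //; right.
exists 0; first by move=> B _ B0; apply: (pos 0) => //; left.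
by rewrite subr0 e1.
Qed.

Lemma diam1_minimizer : (0 < n)%N ->
  exists mu : probability (borel_rV R n) R, energy_infty lam mu = minE /\ diam (supp mu) = 1%E.
Proof.
move=> n0; have [minEy|] := ltP minE +oo%E.
  have [mu [dmu muE]] := minimizer_exists minEy.
  by exists mu; rewrite energy_inftyE//; split=> //; exact: minimizer_diam.
rewrite leye_eq => /eqP minEy.
have [mu dmu] := diam1_measure_exists n0; exists mu; split=> //.
by apply/eqP; rewrite eq_le minE_le minEy leey.
Qed.

Lemma capacity_supp_minimizer mu W : energy_infty lam mu = minE ->
  (diam W <= 1)%E -> supp mu `<=` W -> capacity lam W = maxC.
Proof.
move=> muE dW sW; rewrite max_capacityE /capacity; congr (_^-1)%E.
apply/eqP; rewrite eq_le minE_le_min_riesz_energy// andbT -muE.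
rewrite energy_inftyE; last by rewrite (le_trans _ dW)// diam_le.
by apply: ereal_inf_lbound; exists mu.
Qed.

End minimizers.

Theorem lemma7 (R : realType) (n : nat) (lam : R) (hn : (1 <= n)%N)
    (hlam0 : 0 < lam) (hlamn : lam < n%:R) :
  let minE : \bar R :=
    ereal_inf [set energy_infty lam nu
              | nu in [set: probability (borel_rV R n) R]] in
  let maxC : \bar R :=
    ereal_sup [set capacity lam A
              | A in [set A : set 'rV[R]_n | (diam A <= 1)%E]] in
  [/\ minE = (maxC^-1)%E,
      exists mu : probability (borel_rV R n) R,
        [/\ energy_infty lam mu = minE,
            diam (supp mu) = 1%E &
            exists W : set 'rV[R]_n,
              [/\ convex_body W, constant_width W 1, supp mu `<=` W,
                  (diam W <= 1)%E & capacity lam W = maxC]] &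
      forall W : set 'rV[R]_n,
        convex_body W -> constant_width W 1 ->
        (forall W' : set 'rV[R]_n, convex_body W' -> constant_width W' 1 ->
          (capacity lam W' <= capacity lam W)%E) ->
        (exists mu : probability (borel_rV R n) R,
          equilibrium_measure lam W mu) /\
        (forall mu : probability (borel_rV R n) R,
          equilibrium_measure lam W mu -> energy_infty lam mu = minE)].
Proof.
move=> minE maxC.
have maxCE : maxC = (minE^-1)%E := max_capacityE hlam0.
have [mu [muE dmu]] := diam1_minimizer hlam0 hn.
have [W [sW Wc]] : exists W, supp mu `<=` W /\ complete W.
  by apply: completion; rewrite dmu.
have W0 : W !=set0 by have [x sx] := supp_nonempty mu; exists x; exact: sW.
have dW := complete_diam Wc.
have WmaxC : capacity lam W = maxC by exact: (capacity_supp_minimizer hlam0 muE).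
have bW := complete_convex_body Wc hn W0.
have wW := complete_constant_width Wc W0.
split; first by rewrite maxCE inveK.
  by exists mu; split=> //; exists W.
move=> W' [cW' _ iW'] wW' W'max.
have dW' := constant_width_diam wW'.
(* The completion [W] built above has constant width 1 and capacity [maxC], so it is among the
   bodies that [W'] dominates; conversely [W'] has diameter at most 1 and competes in [maxC]. *)
have W'maxC : capacity lam W' = maxC.
  apply/eqP; rewrite eq_le -[in X in _ && X]WmaxC W'max// andbT.
  by apply: ereal_sup_ubound; exists W'.
split.
  apply: equilibrium_measure_exists => //.
  by have [x /interior_subset W'x] := iW'; exists x.
move=> nu [sW' nuE].
rewrite energy_inftyE; last by rewrite (le_trans _ dW')// diam_le.
by rewrite nuE -[RHS]inveK -maxCE -W'maxC inveK.
Qed.
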